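(* Let $\mu$ be a probability measure on $\mathbb{R}$ with all moments finite and with Jacobi parameters $$J(\mu)=\begin{pmatrix}\beta_0,&\beta_1,&\beta_2,&\beta_3,&\dots\\ \gamma_0,&\gamma_1,&\gamma_2,&\gamma_3,&\dots\end{pmatrix}.$$ (1) If for $t\in\mathbb{N}$ the Jacobi parameters of the free convolution powers, $$J(\mu^{\boxplus t})=\begin{pmatrix}\beta_0(t),&\beta_1(t),&\beta_2(t),&\dots\\ \gamma_0(t),&\gamma_1(t),&\gamma_2(t),&\dots\end{pmatrix},$$ are all polynomials in $t$, then $$\beta_1=\beta_2=\beta_3=\dots\quad\text{and}\quad \gamma_1=\gamma_2=\gamma_3=\dots,$$ so that $\mu$ is a free Meixner distribution. (2) Conversely, suppose $\beta_1=\beta_2=\beta_3=\dots$ and $\gamma_1=\gamma_2=\gamma_3=\dots$, and put $b:=\beta_1-\beta_0$, $c:=\gamma_1-\gamma_0$. Then the free convolution power $\mu_t=\mu^{\boxplus t}$ is well defined (as a probability measure) whenever $t\ge 0$ and $c+t\gamma_0\ge 0$, and then $$J(\mu_t)=\begin{pmatrix}\beta_0 t,& b+\beta_0 t,& b+\beta_0 t,& b+\beta_0 t,&\dots\\ \gamma_0 t,& c+\gamma_0 t,& c+\gamma_0 t,& c+\gamma_0 t,&\dots\end{pmatrix}.$$ In particular, $\mu$ is $\boxplus$-infinitely divisible if and only if $c\ge 0$. In this case $$R^{\mu}(z)=\beta_0 z+\gamma_0 z^2\int_{\mathbb{R}}\frac{d\rho(x)}{1-zx},$$ where $\rho$ is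 the (semicircular) probability measure with $$J(\rho)=\begin{pmatrix}b,&b,&b,&\dots\\ c,&c,&c,&\dots\end{pmatrix}.$$
   Context: Jacobi parameters: for a probability measure $\mu$ on $\mathbb{R}$ with finite moments, let $P_0=1$, $P_{-1}=0$, and let $P_m$ be the monic orthogonal polynomials of $\mu$; they satisfy $xP_m(x)=P_{m+1}(x)+\beta_mP_m(x)+\gamma_{m-1}P_{m-1}(x)$ with $\beta_m\in\mathbb{R}$, $\gamma_m\ge0$. One writes $J(\mu)$ for the two-row array of $(\beta_m)$ and $(\gamma_m)$. If $\mu$ has support of size $N<\infty$, then $\gamma_{N-1}=0$ and all parameters after the first vanishing $\gamma$ are undefined and are to be disregarded. Free cumulants $r_n(\mu)$ are defined by $s_m(\mu)=\int x^m d\mu=\sum_{\pi\in NC(m)}\prod_{V\in\pi}r_{|V|}(\mu)$, where $NC(m)$ is the set of noncrossing partitions of $\{1,\dots,m\}$. The free convolution is defined by $r_n(\mu\boxplus\nu)=r_n(\mu)+r_n(\nu)$; for real $t\ge0$, $\mu^{\boxplus t}$ denotes the probability measure (if it exists) with $r_n(\mu^{\boxplus t})=t\,r_n(\mu)$ for all $n$; $\mu$ is $\boxplus$-infinitely divisible if $\mu^{\boxplus t}$ exists for all $t\ge0$. The ($R$-transform) free cumulant generating function is the formal series $R^\mu(z)=\sum_{k\ge1}r_k(\mu)z^k$. A free Meixner distribution is a measure whose Jacobi parameters satisfy $\beta_1=\beta_2=\cdots$ and $\gamma_1=\gamma_2=\cdots$. *)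

(* Defs.v *)
From HB Require Import structures.
From mathcomp Require Import all_boot all_order all_algebra.
From mathcomp Require Import all_classical all_reals all_analysis.

Set Implicit Arguments.
Unset Strict Implicit.
Unset Printing Implicit Defensive.

Import Order.TTheory GRing.Theory Num.Theory.
Import numFieldNormedType.Exports.

Local Open Scope ring_scope.

Section Moments.
Variable R : realType.
Implicit Type mu : probability R R.

Definition finite_moments mu : Prop :=
  forall n, mu.-integrable setT (fun x : R => (x ^+ n)%:E).

Definition moment mu (n : nat) : R := \int[mu]_x (x ^+ n).

Lemma moment0 mu : moment mu 0 = 1.
Proof.
rewrite /moment; under eq_Rintegral do rewrite expr0.
by rewrite Rintegral_cst//= probability_setT mul1r.
Qed.

End Moments.

Section NoncrossingPartitions.
Variable m : nat.
Implicit Type p : {set {set 'I_m}}.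

Definition noncrossing p : bool :=
  [forall V in p, forall W in p, forall a in V, forall b in W,
     forall c in V, forall d in W, (a < b < c)%N && (c < d)%N ==> (V == W)].

Definition NC : {set {set {set 'I_m}}} :=
  [set p : {set {set 'I_m}} |
    finset.partition p [set: 'I_m] && noncrossing p]%SET.

End NoncrossingPartitions.

Section FreeCumulants.
Variable R : realType.
Implicit Types (mu nu : probability R R) (s r : nat -> R).

Definition nc_sum r (m : nat) : R := \sum_(p in NC m) \prod_(V in p) r #|V|.

(* Blocks are nonempty, so the moment-cumulant formula leaves r 0 free; it is
   set to 0, which is also the constant term of the R-transform. *)
Definition is_free_cumulants s r : Prop :=
  r 0%N = 0 /\ forall m, s m = nc_sum r m.

Definition free_cumulant mu : nat -> R :=
  xget (fun=> 0) (is_free_cumulants (moment mu)).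

(* The formal series, given by its coefficients. *)
Definition R_transform mu : nat -> R := free_cumulant mu.

Definition is_free_power mu (t : R) nu : Prop :=
  finite_moments nu /\ forall n, (0 < n)%N ->
    free_cumulant nu n = t * free_cumulant mu n.

Definition free_infinitely_divisible mu : Prop :=
  forall t : R, 0 <= t -> exists nu : probability R R, is_free_power mu t nu.

(* Existence and uniqueness of the solution of the moment-cumulant formula. *)

Let nc_sum_rest r (m : nat) : R :=
  \sum_(p in NC m | p != [set [set: 'I_m]]%SET) \prod_(V in p) r #|V|.

Let NC_full m : [set [set: 'I_m.+1]]%SET \in NC m.+1.
Proof.
rewrite inE; apply/andP; split.
  apply/and3P; split; first by rewrite /finset.cover big_set1.
    by apply/finset.trivIsetP => A B /set1P-> /set1P->; rewrite eqxx.
  by rewrite inE; apply/eqP => /setP /(_ ord0); rewrite !inE.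
apply/forall_inP => V /set1P->; apply/forall_inP => W /set1P->.
do 4 (apply/forall_inP => ? _).
by rewrite eqxx implybT.
Qed.

Let nc_sumS r m : nc_sum r m.+1 = r m.+1 + nc_sum_rest r m.+1.
Proof.
rewrite /nc_sum (bigD1 _ (NC_full m)) /=; congr (_ + _).
by rewrite big_set1 cardsT card_ord.
Qed.

Let NC_block m (p : {set {set 'I_m}}) V :
  p \in NC m -> p != [set [set: 'I_m]]%SET -> V \in p -> (#|V| < m)%N.
Proof.
rewrite inE => /andP[/and3P[_ /finset.trivIsetP tp p0] _] pT Vp.
rewrite -[X in (_ < X)%N](card_ord m) -cardsT; apply: proper_card.
rewrite properT; apply: contra pT => /eqP VT.
apply/eqP/setP => W; rewrite inE; apply/idP/eqP => [Wp|->]; last by rewrite -VT.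
apply: contraTeq Wp => WT; apply/negP => Wp.
have := tp _ _ Wp Vp; rewrite VT WT => /(_ isT).
rewrite -setI_eq0 finset.setIT => /eqP W0.
by move: p0; rewrite -W0 Wp.
Qed.

Let eq_nc_sum_rest r r' m :
  (forall k, (k < m)%N -> r k = r' k) -> nc_sum_rest r m = nc_sum_rest r' m.
Proof.
move=> rr'; apply: eq_bigr => p /andP[pNC pT].
by apply: eq_bigr => V Vp; apply: rr'; exact: NC_block pNC pT Vp.
Qed.

Let nc_sum0 r : nc_sum r 0 = 1.
Proof.
have S0 (A : {set 'I_0}) : A = finset.set0 by apply/setP => -[].
have NC0 : NC 0 = [set finset.set0]%SET.
  apply/setP => p; rewrite !inE; apply/idP/eqP => [/andP[/and3P[_ _ p0] _]|->].
    apply/setP => A; rewrite inE; apply/negbTE; apply: contra p0.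
    by rewrite (S0 A).
  apply/andP; split.
    apply/and3P; split; first by rewrite [X in _ == X]S0 /finset.cover big_set0.
      by apply/finset.trivIsetP => A B; rewrite inE.
    by rewrite inE.
  by apply/forall_inP => V; rewrite inE.
by rewrite /nc_sum NC0 big_set1 big_set0.
Qed.

Let Fixpoint cumulants_upto s (n : nat) : nat -> R :=
  if n is n'.+1 then
    let r := cumulants_upto s n' in
    fun k => if k == n then s n - nc_sum_rest r n else r k
  else fun=> 0.

Let cumulants_uptoE s n k : (k <= n)%N ->
  cumulants_upto s n k = cumulants_upto s k k.
Proof.
elim: n => [|n IHn]; first by rewrite leqn0 => /eqP->.
rewrite leq_eqVlt => /predU1P[->//|]; rewrite ltnS => kn /=.
by rewrite ltn_eqF ?ltnS// IHn.
Qed.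

Lemma is_free_cumulants_exists s : s 0%N = 1 -> exists r, is_free_cumulants s r.
Proof.
move=> s0; exists (fun k => cumulants_upto s k k); split=> // -[|m].
  by rewrite nc_sum0.
rewrite nc_sumS /= eqxx (@eq_nc_sum_rest _ (cumulants_upto s m)) ?subrK//.
by move=> k km; rewrite cumulants_uptoE.
Qed.

Lemma is_free_cumulants_unique s r r' :
  is_free_cumulants s r -> is_free_cumulants s r' -> forall k, r k = r' k.
Proof.
move=> [r0 sr] [r'0 sr'] k; elim/ltn_ind: k => -[_|k IH]; first by rewrite r0.
have := sr k.+1; rewrite sr' !nc_sumS (eq_nc_sum_rest IH).
by move/addIr.
Qed.

Lemma free_cumulantP mu : is_free_cumulants (moment mu) (free_cumulant mu).
Proof.
have [r hr] := is_free_cumulants_exists (moment0 mu).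
by rewrite /free_cumulant; case: xgetP => [? _ //|/(_ r)].
Qed.

End FreeCumulants.

Section JacobiParameters.
Variable R : realType.
Implicit Types (mu : probability R R) (beta gamma : nat -> R).

(* If mu has N < oo support points, the conditions force gamma (N - 1) = 0 and
   leave beta m and gamma m unconstrained for m >= N (apart from the sign
   convention on gamma), since the polynomials P m, m >= N, vanish mu-a.e.
   The parameters past the first zero gamma are thus disregarded. *)
Definition is_jacobi mu beta gamma : Prop :=
  [/\ finite_moments mu,
      forall m, 0 <= gamma m &
      exists P : nat -> {poly R},
        [/\ P 0%N = 1,
            forall m, P m \is monic /\ size (P m) = m.+1,
            forall m k, m != k -> \int[mu]_x ((P m).[x] * (P k).[x]) = 0,
            'X * P 0%N = P 1%N + beta 0%N *: P 0%N &
            forall m, 'X * P m.+1 =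
              P m.+2 + beta m.+1 *: P m.+1 + gamma m *: P m]].

(* The m-th column of the array is not past the first zero gamma. *)
Definition jacobi_defined gamma (m : nat) : Prop :=
  forall i, (i < m)%N -> gamma i != 0.

Definition jacobi_tail_constant beta gamma : Prop :=
  forall m, (1 <= m)%N -> jacobi_defined gamma m ->
    beta m = beta 1%N /\ gamma m = gamma 1%N.

Definition free_meixner mu : Prop :=
  exists beta gamma : nat -> R,
    is_jacobi mu beta gamma /\ jacobi_tail_constant beta gamma.

End JacobiParameters.

(* Main.v *)
(** A measure with Jacobi parameters [beta], [gamma] has the weighted Motzkin
    path sums as moments.  For the tail-constant parameters [(b0 t, b + b0 t, ...;
    g0 t, c + g0 t, ...)] the generating functions [S], [T] of these sums satisfy
    quadratic equations in which [T / S] is the semicircular series with parameters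
    [(b, c)] composed with [z S]; comparing with the functional equation of the
    noncrossing moment-cumulant formula, the free cumulants are [t] times
    [b0, g0 s_0, g0 s_1, ...], [s_k] being the semicircular moments.  This gives (2),
    apart from the existence of the measures, which is Favard's theorem for bounded
    parameters: after an affine change of variables it becomes a Hausdorff moment
    problem.

    For (1), compare with the tail-constant model having the same first two columns.
    At the first order where the cumulants differ, the corresponding Jacobi parameter
    of the [t]-th power deviates from the model by a constant multiple of
    [(c + g0 t) ^ - (m - 1)], which is not polynomial in [t] when [m >= 2]. *)

Require Import Defs.
From HB Require Import structures.
From mathcomp Require Import all_boot all_order all_algebra.
From mathcomp Require Import all_classical all_reals all_analysis.
From mathcomp Require Import measurable_realfun ring lra zify.

Set Implicit Arguments.
Unset Strict Implicit.
Unset Printing Implicit Defensive.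

Import Order.TTheory GRing.Theory Num.Theory.
Import numFieldNormedType.Exports.

Local Open Scope ring_scope.

(** * Recursion for sums over noncrossing partitions *)

(** Columns past the first zero gamma carry no information, so parameters are compared through
    moments: [is_jacobi] is traded for the statement that the moments are Motzkin sums, and
    parameters are recovered from moments only in defined columns. The moment-cumulant formula is
    opened by peeling the block of the first point one point at a time. This needs sums indexed by
    the number j of points already peeled, hence a sequence of series with F_j = r_{j+1} S + z S
    F_{j+1}. Tails of the semicircular series evaluated at zS solve it; composition of series is
    bypassed by building these tails directly, as the coefficients of a series over series. In
    Favard's theorem, positivity comes from the norm bound B + 2K of a Jacobi matrix with diagonal
    at most B and off-diagonal at most K in absolute value. The measure is the law of a limit of
    quantile functions: weak compactness is replaced by pointwise limits, and the exchange of limit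
    and integral by Riemann sums whose error is the same for all monotone functions with values in
    [0, 1]. *)

Section NoncrossingSubsets.
Variables (R : comPzRingType) (m : nat).
Implicit Types (A B S V W : {set 'I_m}) (p q : {set {set 'I_m}}).
Implicit Type phi : {set 'I_m} -> R.

Definition NCs S : {set {set {set 'I_m}}} :=
  [set p : {set {set 'I_m}} | finset.partition p S && noncrossing p]%SET.

Definition nc_weight phi S : R := \sum_(p in NCs S) \prod_(V in p) phi V.

Lemma noncrossingP p : reflect
  (forall V W (a b c d : 'I_m), V \in p -> W \in p -> a \in V -> b \in W ->
     c \in V -> d \in W -> (a < b)%N -> (b < c)%N -> (c < d)%N -> V = W)
  (noncrossing p).
Proof.
apply: (iffP idP) => [h V W a b c d Vp Wp aV bW cV dW ab bc cd|h].
  move/forall_inP/(_ _ Vp)/forall_inP/(_ _ Wp)/forall_inP/(_ _ aV) : h.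
  move/forall_inP/(_ _ bW)/forall_inP/(_ _ cV)/forall_inP/(_ _ dW).
  by rewrite ab bc cd => /eqP.
apply/forall_inP => V Vp; apply/forall_inP => W Wp; apply/forall_inP => a aV.
apply/forall_inP => b bW; apply/forall_inP => c cV; apply/forall_inP => d dW.
by apply/implyP => /andP[/andP[ab bc] cd]; apply/eqP; exact: (h _ _ a b c d).
Qed.

Lemma partitionsP p S : reflect
  [/\ forall V, V \in p -> V \subset S,
      forall x, x \in S -> exists2 V, V \in p & x \in V,
      forall V W x, V \in p -> W \in p -> x \in V -> x \in W -> V = W &
      forall V, V \in p -> exists x, x \in V]
  (finset.partition p S).
Proof.
apply: (iffP idP) => [/and3P[/eqP cp /finset.trivIsetP tp p0]|[h1 h2 h3 h4]].
  split=> [V Vp|x|V W x Vp Wp xV xW|V Vp].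
  - by rewrite -cp; exact: (finset.bigcup_sup V).
  - by rewrite -cp => /finset.bigcupP[V Vp xV]; exists V.
  - apply/eqP/negPn/negP => VW; have := tp _ _ Vp Wp VW.
    by rewrite -setI_eq0 => /eqP/setP/(_ x); rewrite !inE xV xW.
  - by apply/finset.set0Pn; apply: contraNneq p0 => <-.
apply/and3P; split.
- rewrite finset.eqEsubset; apply/andP; split.
    by apply/finset.bigcupsP => V /h1.
  by apply/fintype.subsetP => x /h2[V Vp xV]; apply/finset.bigcupP; exists V.
- apply/finset.trivIsetP => V W Vp Wp; apply: contraNT.
  by rewrite -setI_eq0 => /finset.set0Pn[x /setIP[xV xW]]; apply/eqP; exact: (h3 _ _ x).
- by apply/negP => /h4[x]; rewrite inE.
Qed.

Definition splits A B p := [forall V in p, (V \subset A) || (V \subset B)].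

(* Blocks inside [A] cannot cross blocks inside [B] because no element of [B]
   lies between two elements of [A]. *)
Lemma nc_weightU phi A B : [disjoint A & B] ->
  (forall a b c, a \in A -> b \in B -> c \in A -> ~~ (a < b < c)%N) ->
  \sum_(p in NCs (A :|: B) | splits A B p) \prod_(V in p) phi V =
  nc_weight phi A * nc_weight phi B.
Proof.
move=> dAB conv; rewrite /nc_weight big_distrlr /= pair_big /=.
have ABF x : x \in A -> x \in B -> False.
  by move=> xA xB; move/pred0P/(_ x): dAB => /=; rewrite xA xB.
rewrite (reindex_onto (fun q : {set {set 'I_m}} * {set {set 'I_m}} => (q.1 :|: q.2)%SET)
  (fun p => ([set V in p | V \subset A]%SET, [set V in p | V \subset B]%SET))).
  have key (q : {set {set 'I_m}} * {set {set 'I_m}}) :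
      ((q.1 :|: q.2)%SET \in NCs (A :|: B)) && splits A B (q.1 :|: q.2)%SET &&
      (([set V in (q.1 :|: q.2)%SET | V \subset A]%SET,
        [set V in (q.1 :|: q.2)%SET | V \subset B]%SET) == q) =
      (q.1 \in NCs A) && (q.2 \in NCs B).
    case: q => p q /=; rewrite !inE xpair_eqE; apply/idP/idP.
      move=> /andP[/andP[/andP[/partitionsP[h1 h2 h3 h4] /noncrossingP nc] sp]].
      move=> /andP[/eqP pE /eqP qE].
      have pA V : V \in p -> V \subset A by rewrite -pE !inE => /andP[].
      have qB V : V \in q -> V \subset B by rewrite -qE !inE => /andP[].
      have pin V : V \in p -> V \in (p :|: q)%SET by rewrite inE => ->.
      have qin V : V \in q -> V \in (p :|: q)%SET by rewrite inE orbC => ->.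
      apply/andP; split; apply/andP; split.
      - apply/partitionsP; split=> [//|x xA|V W x /pin Vp /pin Wp|V /pin /h4//].
          have [|V] := h2 x; first by rewrite inE xA.
          rewrite inE => /orP[Vp|/qB/fintype.subsetP VB] xV; first by exists V.
          by case: (ABF x) => //; exact: VB.
        exact: h3.
      - apply/noncrossingP => V W a b c d /pin Vp /pin Wp; exact: nc.
      - apply/partitionsP; split=> [//|x xB|V W x /qin Vp /qin Wp|V /qin /h4//].
          have [|V] := h2 x; first by rewrite inE xB orbT.
          rewrite inE => /orP[/pA/fintype.subsetP VA|Vp] xV; last by exists V.
          by case: (ABF x) => //; exact: VA.
        exact: h3.
      - apply/noncrossingP => V W a b c d /qin Vp /qin Wp; exact: nc.
    move=> /andP[/andP[/partitionsP[p1 p2 p3 p4] /noncrossingP pnc]].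
    move=> /andP[/partitionsP[q1 q2 q3 q4] /noncrossingP qnc].
    have pqF V W x : V \in p -> W \in q -> x \in V -> x \in W -> False.
      move=> /p1/fintype.subsetP VA /q1/fintype.subsetP WB xV xW.
      by apply: (ABF x); [exact: VA|exact: WB].
    apply/andP; split; [apply/andP; split; [apply/andP; split|]|].
    - apply/partitionsP; split.
      + move=> V; rewrite inE => /orP[/p1 VA|/q1 VB].
          by apply: (fintype.subset_trans VA); exact: finset.subsetUl.
        by apply: (fintype.subset_trans VB); exact: finset.subsetUr.
      + move=> x; rewrite inE => /orP[/p2|/q2] [V Vp xV]; exists V => //.
          by rewrite inE Vp.
        by rewrite inE Vp orbT.
      + move=> V W x; rewrite !inE => /orP[Vp|Vq] /orP[Wp|Wq] xV xW.
        * exact: (p3 _ _ x).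
        * by case: (pqF _ _ _ Vp Wq xV xW).
        * by case: (pqF _ _ _ Wp Vq xW xV).
        * exact: (q3 _ _ x).
      + by move=> V; rewrite inE => /orP[/p4|/q4].
    - apply/noncrossingP => V W a b c d; rewrite !inE.
      move=> /orP[Vp|Vq] /orP[Wp|Wq] aV bW cV dW ab bc cd.
      + exact: (pnc _ _ a b c d).
      + have /fintype.subsetP VA := p1 _ Vp; have /fintype.subsetP WB := q1 _ Wq.
        by have := conv a b c (VA _ aV) (WB _ bW) (VA _ cV); rewrite ab bc.
      (* Here the block inside [A] comes second, so the forbidden triple consists of the last three
         points. *)
      + have /fintype.subsetP WA := p1 _ Wp; have /fintype.subsetP VB := q1 _ Vq.
        by have := conv b c d (WA _ bW) (VB _ cV) (WA _ dW); rewrite cd bc.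
      + exact: (qnc _ _ a b c d).
    - apply/forall_inP => V; rewrite inE => /orP[/p1->//|/q1->].
      by rewrite orbT.
    - apply/andP; split; apply/eqP/setP => V; rewrite !inE.
        apply/andP/idP => [[/orP[//|Vq] /fintype.subsetP VA]|Vp].
          have [x xV] := q4 _ Vq; have /fintype.subsetP VB := q1 _ Vq.
          by case: (ABF x); [exact: VA|exact: VB].
        by rewrite Vp p1.
      apply/andP/idP => [[/orP[Vp|//] /fintype.subsetP VB]|Vq].
        have [x xV] := p4 _ Vp; have /fintype.subsetP VA := p1 _ Vp.
        by case: (ABF x); [exact: VA|exact: VB].
      by rewrite Vq q1 // orbT.
  apply: eq_big => [q|[p q] /=]; first by rewrite -key.
  have := key (p, q); rewrite /= => -> /andP[].
  rewrite !inE => /andP[/partitionsP[p1 p2 p3 p4] _].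
  move=> /andP[/partitionsP[q1 q2 q3 q4] _].
  rewrite -bigU //=; first by apply: eq_bigl => V; rewrite !inE.
  apply/pred0P => V /=; apply/negbTE/negP => /andP[Vp Vq].
  have [x xV] := p4 _ Vp; apply: (ABF x).
    by move/fintype.subsetP: (p1 _ Vp) => /(_ _ xV).
  by move/fintype.subsetP: (q1 _ Vq) => /(_ _ xV).
move=> p /andP[_ /forall_inP sp]; apply/setP => V; rewrite !inE -andb_orr.
by apply/andP/idP => [[]//|Vp]; split => //; exact: sp.
Qed.

(* Removing the point [a], which immediately precedes [i], from the block of
   [i] keeps a partition noncrossing, and so does adding it back. *)
Lemma nc_weight_adjoin phi (a i : 'I_m) B :
  i \in B -> (forall x, x \in B -> i <= x)%N -> (a < i)%N ->
  (forall V, a \in V -> i \notin V -> phi V = 0) ->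
  nc_weight phi (a |: B) =
  nc_weight (fun V => phi (if i \in V then a |: V else V)%SET) B.
Proof.
move=> iB iminB ai phi0.
have aB : a \notin B by apply: contraL ai => /iminB; rewrite -leqNgt.
rewrite /nc_weight (bigID (fun p => i \in finset.pblock p a)) /= [X in _ + X]big1.
  rewrite addr0.
  (* These maps are mutually inverse only between partitions of [B] and partitions in which [a] and
     [i] share a block; hence the preceding case split, whose other part vanishes by [phi0]. *)
  pose ad V := if i \in V then (a |: V)%SET else V.
  pose rm V := (V :\ a)%SET.
  rewrite (reindex_onto (fun p : {set {set 'I_m}} => [set ad V | V in p]%SET)
    (fun p : {set {set 'I_m}} => [set rm V | V in p]%SET)).
    have key p : (([set ad V | V in p]%SET \in NCs (a |: B)) &&
        (i \in finset.pblock [set ad V | V in p]%SET a) &&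
        ([set rm V | V in [set ad V | V in p]%SET]%SET == p)) = (p \in NCs B).
      rewrite !inE; apply/idP/idP.
        move=> /andP[/andP[/andP[pp /noncrossingP nc] ipa] /eqP pE].
        have [h1 h2 h3 h4] := partitionsP _ _ pp.
        have adp V : V \in p -> ad V \in [set ad V | V in p]%SET.
          by move=> ?; exact: imset_f.
        have paV V : V \in p -> a \notin V.
          by rewrite -pE => /imsetP[W _ ->]; rewrite /rm !inE eqxx.
        have adin V x : x \in V -> x \in ad V.
          by rewrite /ad; case: ifP => // _ xV; rewrite inE xV orbT.
        have adeq V W : V \in p -> W \in p -> ad V = ad W -> V = W.
          move=> Vp Wp VW.
          have rmad U : U \in p -> rm (ad U) = U.
            move=> Up; rewrite /rm /ad; case: ifP => _.
              by rewrite setU1K ?paV.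
            apply/setP => x; rewrite !inE; case: eqP => //= ->.
            by apply/esym/negbTE/paV.
          by rewrite -(rmad _ Vp) -(rmad _ Wp) VW.
        apply/andP; split.
          apply/partitionsP; split.
          - move=> V Vp; apply/fintype.subsetP => x xV.
            have /fintype.subsetP/(_ _ (adin _ _ xV)) := h1 _ (adp _ Vp).
            by rewrite !inE => /orP[/eqP xa|//]; move: (paV _ Vp); rewrite -xa xV.
          - move=> x xB; have [|V] := h2 x; first by rewrite !inE xB orbT.
            move=> /imsetP[W Wp ->] xW; exists W => //.
            move: xW; rewrite /ad; case: ifP => // _; rewrite !inE.
            by case/orP => [/eqP xa|//]; move: aB; rewrite -xa xB.
          - move=> V W x Vp Wp xV xW; apply: adeq => //.
            by apply: (h3 _ _ x); [exact: adp|exact: adp|exact: adin|exact: adin].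
          - move=> V Vp; move: (Vp); rewrite -pE => /imsetP[W Wp VE].
            have [x xW] := h4 _ Wp; have [xa|xa] := eqVneq x a; last first.
              by exists x; rewrite VE !inE xa.
            (* Removing [a] cannot empty its block, because [i] stays in it. *)
            exists i; rewrite VE !inE; apply/andP; split.
              by apply: contraTneq ai => ->; rewrite ltnn.
            rewrite -(@def_pblock _ _ _ a _ Wp) ?ipa //; last by rewrite -xa.
            by case/and3P: pp.
        apply/noncrossingP => V W x y c d Vp Wp xV yW cV dW xy yc cd.
        apply: adeq => //.
        by apply: (nc _ _ x y c d); rewrite ?adp ?adin.
      move=> /andP[/partitionsP[h1 h2 h3 h4] /noncrossingP nc].
      have paV V : V \in p -> a \notin V.
        by move=> /h1/fintype.subsetP VB; apply/negP => /VB; rewrite (negbTE aB).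
      have rmad U : U \in p -> rm (ad U) = U.
        move=> Up; rewrite /rm /ad; case: ifP => _; first by rewrite setU1K ?paV.
        apply/setP => x; rewrite !inE; case: eqP => //= ->.
        by apply/esym/negbTE/paV.
      have adinP V x : V \in p -> x \in ad V -> x \in V \/ (x = a /\ i \in V).
        move=> Vp; rewrite /ad; case: ifP => [iV|_]; last by left.
        by rewrite !inE => /orP[/eqP->|?]; [right|left].
      have adin V x : x \in V -> x \in ad V.
        by rewrite /ad; case: ifP => // _ xV; rewrite inE xV orbT.
      have pp : finset.partition [set ad V | V in p]%SET (a |: B)%SET.
        apply/partitionsP; split.
        - move=> _ /imsetP[V Vp ->]; apply/fintype.subsetP => x.
          move=> /(adinP _ _ Vp)[xV|[-> _]]; last by rewrite !inE eqxx.
          by rewrite inE (fintype.subsetP (h1 _ Vp)) // orbT.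
        - move=> x; rewrite !inE => /orP[/eqP->|/h2[V Vp xV]].
            have [V Vp iV] := h2 _ iB; exists (ad V); first exact: imset_f.
            by rewrite /ad iV !inE eqxx.
          by exists (ad V); [exact: imset_f|exact: adin].
        - move=> _ _ x /imsetP[V Vp ->] /imsetP[W Wp ->].
          move=> /(adinP _ _ Vp)[xV|[xa iV]] /(adinP _ _ Wp)[xW|[xa' iW]].
          + by rewrite (h3 _ _ x Vp Wp).
          + by move: (paV _ Vp); rewrite -xa' xV.
          + by move: (paV _ Wp); rewrite -xa xW.
          + by rewrite (h3 _ _ i Vp Wp).
        - by move=> _ /imsetP[V Vp ->]; have [x xV] := h4 _ Vp; exists x; exact: adin.
      have [V0 V0p iV0] := h2 _ iB.
      rewrite pp /=; apply/andP; split; first (apply/andP; split).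
      - apply/noncrossingP => _ _ x y c d /imsetP[V Vp ->] /imsetP[W Wp ->].
        move=> xV yW cV dW xy yc cd.
        have gti z : z \in a |: B -> (a < z)%N -> z \in B /\ (i <= z)%N.
          rewrite !inE => /orP[/eqP->|zB]; rewrite ?ltnn// => _.
          by split=> //; exact: iminB.
        have sub U z : U \in p -> z \in ad U -> z \in (a |: B)%SET.
          move=> Up /(adinP _ _ Up)[zU|[-> _]]; last by rewrite !inE eqxx.
          by rewrite inE (fintype.subsetP (h1 _ Up)) // orbT.
        have ale z : z \in (a |: B)%SET -> (a <= z)%N.
          rewrite !inE => /orP[/eqP->//|/iminB]; apply: leq_trans; exact: ltnW.
        have ax := ale _ (sub _ _ Vp xV).
        have ay := leq_ltn_trans ax xy.
        have ac := ltn_trans ay yc; have ad' := ltn_trans ac cd.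
        have notA U z : U \in p -> z \in ad U -> (a < z)%N -> z \in U.
          by move=> Up /(adinP _ _ Up)[//|[-> _]]; rewrite ltnn.
        have yW' := notA _ _ Wp yW ay; have cV' := notA _ _ Vp cV ac.
        have dW' := notA _ _ Wp dW ad'.
        have [xV'|[xa iV]] := adinP _ _ Vp xV.
          by rewrite (nc _ _ x y c d Vp Wp xV' yW' cV' dW').
        (* The crossing starts at the added point [a]. As [i] lies in the same block and is minimal
           in [B], it can replace [a], unless [i = y], when both blocks contain [i]. *)
        have yB : y \in B by apply: (fintype.subsetP (h1 _ Wp)).
        move: (iminB _ yB); rewrite leq_eqVlt => /orP[/eqP iy|iy].
          by rewrite (h3 V W i Vp Wp iV) // (_ : i = y) //; exact: val_inj.
        by rewrite (nc _ _ i y c d Vp Wp iV yW' cV' dW').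
      - have tp : finset.trivIset [set ad V | V in p]%SET by case/and3P: pp.
        have aV0 : a \in ad V0 by rewrite /ad iV0 !inE eqxx.
        by rewrite (def_pblock tp (imset_f ad V0p) aV0) adin.
      - apply/eqP/setP => V; apply/imsetP/idP => [[_ /imsetP[W Wp ->] ->]|Vp].
          by rewrite rmad.
        by exists (ad V); [exact: imset_f|rewrite rmad].
    apply: eq_big => [p|p]; first by rewrite -key.
    rewrite key inE => /andP[/partitionsP[h1 h2 h3 h4] _].
    rewrite big_imset //= => V W Vp Wp.
    have paV U : U \in p -> a \notin U.
      by move=> /h1/fintype.subsetP VB; apply/negP => /VB; rewrite (negbTE aB).
    move=> /setP adVW; apply/setP => x; have := adVW x.
    have [->|xa] := eqVneq x a; first by rewrite (negbTE (paV _ Vp)) (negbTE (paV _ Wp)).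
    have adE U : (x \in ad U) = (x \in U).
      by rewrite /ad; case: ifP => // _; rewrite !inE (negbTE xa).
    by rewrite !adE.
  move=> p; rewrite inE => /andP[/andP[pp _] ipa].
  have [h1 h2 h3 h4] := partitionsP _ _ pp.
  have tp : finset.trivIset p by case/and3P: pp.
  have adrm V : V \in p -> ad (rm V) = V.
    move=> Vp; have ia : i != a by apply: contraTneq ai => ->; rewrite ltnn.
    have aiV : a \in V -> i \in V by move=> aV; rewrite -(def_pblock tp Vp aV).
    have iaV : i \in V -> a \in V.
      have [|U Up aU] := h2 a; first by rewrite !inE eqxx.
      move=> iV; rewrite (h3 V U i Vp Up iV) //.
      by rewrite -(def_pblock tp Up aU).
    rewrite /ad /rm !inE ia /=; case: ifP => iV; first by rewrite finset.setD1K ?iaV.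
    apply/setP => x; rewrite !inE; case: eqP => //= ->; apply/esym/negbTE/negP.
    by move/aiV; rewrite iV.
  apply/setP => V; apply/imsetP/idP => [[_ /imsetP[W Wp ->] ->]|Vp].
    by rewrite adrm.
  by exists (rm V); [exact: imset_f|rewrite adrm].
move=> p /andP[]; rewrite inE => /andP[pp _] ipa.
have [h1 h2 h3 h4] := partitionsP _ _ pp.
have [|V Vp aV] := h2 a; first by rewrite !inE eqxx.
have tp : finset.trivIset p by case/and3P: pp.
rewrite (bigD1 V) //= phi0 ?mul0r //.
by rewrite -(def_pblock tp Vp aV).
Qed.

End NoncrossingSubsets.

Lemma nc_weight_imset (R : comPzRingType) (k m : nat) (f : 'I_k -> 'I_m)
    (phi : {set 'I_m} -> R) :
  {mono f : x y / (x < y)%N} ->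
  nc_weight phi (f @: [set: 'I_k])%SET =
  nc_weight (fun V => phi (f @: V)%SET) [set: 'I_k]%SET.
Proof.
move=> fmono.
have finj : injective f.
  move=> x y fxy; apply/val_inj/eqP; rewrite eqn_leq leqNgt -fmono fxy ltnn /=.
  by rewrite leqNgt -fmono fxy ltnn.
have fset_inj : injective (fun V : {set 'I_k} => f @: V)%SET by exact: imset_inj.
rewrite /nc_weight.
rewrite (reindex_onto (fun p : {set {set 'I_k}} =>
            [set (f @: (V : {set 'I_k}))%SET | V in p]%SET)
          (fun p : {set {set 'I_m}} => [set (f @^-1: (V : {set 'I_m}))%SET | V in p]%SET)).
  have preK (V : {set 'I_k}) : (f @^-1: (f @: V))%SET = V.
    by apply/setP => x; rewrite inE mem_imset.
  have key (p : {set {set 'I_k}}) :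
      ([set (f @: (V : {set 'I_k}))%SET | V in p]%SET \in NCs (f @: [set: 'I_k])%SET) &&
      ([set (f @^-1: (V : {set 'I_m}))%SET |
         V in [set (f @: (V : {set 'I_k}))%SET | V in p]%SET]%SET == p) =
      (p \in NCs [set: 'I_k]%SET).
    have -> : [set (f @^-1: (V : {set 'I_m}))%SET |
         V in [set (f @: (V : {set 'I_k}))%SET | V in p]%SET]%SET = p.
      apply/setP => V; apply/imsetP/idP => [[_ /imsetP[W Wp ->] ->]|Vp].
        by rewrite preK.
      by exists (f @: V)%SET; [exact: imset_f|rewrite preK].
    rewrite eqxx andbT !inE.
    apply/andP/andP => -[/partitionsP[h1 h2 h3 h4] /noncrossingP nc].
      split; first (apply/partitionsP; split).
      - by move=> V _; exact: finset.subsetT.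
      - move=> x _; have [|_ /imsetP[V Vp ->]] := h2 (f x); first exact: imset_f.
        by rewrite mem_imset // => xV; exists V.
      - move=> V W x Vp Wp xV xW; apply: fset_inj.
        by apply: (h3 _ _ (f x)); exact: imset_f.
      - move=> V Vp; have [|x /imsetP[y yV _]] := h4 (f @: V)%SET.
          exact: imset_f.
        by exists y.
      apply/noncrossingP => V W a b c d Vp Wp aV bW cV dW ab bc cd.
      by apply: fset_inj; apply: (nc _ _ (f a) (f b) (f c) (f d));
        rewrite ?imset_f ?fmono.
    split; first (apply/partitionsP; split).
    - by move=> _ /imsetP[V Vp ->]; apply: imsetS; exact: finset.subsetT.
    - move=> _ /imsetP[x _ ->]; have [//|V Vp xV] := h2 x.
      by exists (f @: V)%SET; exact: imset_f.
    - move=> _ _ _ /imsetP[V Vp ->] /imsetP[W Wp ->] /imsetP[x xV ->].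
      by rewrite mem_imset // => xW; rewrite (h3 V W x).
    - move=> _ /imsetP[V Vp ->]; have [x xV] := h4 _ Vp.
      by exists (f x); exact: imset_f.
    apply/noncrossingP => V' W' a' b' c' d' /imsetP[V Vp ->] /imsetP[W Wp ->].
    move=> /imsetP[a aV ->] /imsetP[b bW ->] /imsetP[c cV ->] /imsetP[d dW ->].
    by rewrite !fmono => ab bc cd; rewrite (nc V W a b c d).
  apply: eq_big => [p|p _]; first exact: key.
  by rewrite big_imset //= => V W _ _; exact: fset_inj.
move=> p; rewrite inE => /andP[/partitionsP[h1 h2 h3 h4] _].
have imK V : V \in p -> (f @: (f @^-1: V))%SET = V.
  move=> Vp; apply/setP => x; apply/imsetP/idP => [[y]|xV].
    by rewrite inE => yV ->.
  have /fintype.subsetP/(_ _ xV)/imsetP[y _ xE] := h1 _ Vp.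
  by exists y => //; rewrite inE -xE.
apply/setP => V; apply/imsetP/idP => [[_ /imsetP[W Wp ->] ->]|Vp].
  by rewrite imK.
by exists (f @^-1: V)%SET; [exact: imset_f|rewrite imK].
Qed.

Lemma eq_nc_weight (R : comPzRingType) (m : nat) (phi psi : {set 'I_m} -> R)
    (S : {set 'I_m}) :
  (forall V : {set 'I_m}, V \subset S -> phi V = psi V) ->
  nc_weight phi S = nc_weight psi S.
Proof.
move=> h; apply: eq_bigr => p; rewrite inE => /andP[/partitionsP[h1 _ _ _] _].
by apply: eq_bigr => V /h1 /h.
Qed.

Section ShiftOrdinal.
Variables (a k m : nat) (h : (a + k <= m)%N).

Lemma shift_ord_subproof (x : 'I_k) : (a + x < m)%N.
Proof. by apply: leq_trans h; rewrite ltn_add2l. Qed.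

Definition shift_ord (x : 'I_k) : 'I_m := Ordinal (shift_ord_subproof x).

Lemma shift_ord_mono : {mono shift_ord : x y / (x < y)%N}.
Proof. by move=> x y /=; rewrite ltn_add2l. Qed.

Lemma shift_ord_inj : injective shift_ord.
Proof. by move=> x y /(congr1 val) /= /addnI; exact: val_inj. Qed.

Lemma imset_shift_ord :
  (shift_ord @: [set: 'I_k] = [set x : 'I_m | a <= x < a + k]%N)%SET.
Proof.
apply/setP => x; rewrite inE; apply/imsetP/idP => [[y _ ->] /=|/andP[ax xk]].
  by rewrite leq_addr ltn_add2l ltn_ord.
have xak : (x - a < k)%N by rewrite ltn_subLR.
by exists (Ordinal xak); [|apply: val_inj; rewrite /= subnKC].
Qed.

End ShiftOrdinal.

Section NoncrossingRecursion.
Variable R : realType.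
Implicit Type r : nat -> R.

(** The block of the first point is weighted as if it had [j] further points: those already peeled
    off it by the recursion below. *)
Definition nc_sum_first r (j n : nat) : R :=
  nc_weight (fun V : {set 'I_n.+1} => r (#|V| + j * (ord0 \in V))%N)
    [set: 'I_n.+1]%SET.

Lemma nc_sumE r n : nc_sum r n = nc_weight (fun V => r #|V|) [set: 'I_n]%SET.
Proof. by []. Qed.

Lemma nc_sum_firstE r n : nc_sum r n.+1 = nc_sum_first r 0 n.
Proof. by rewrite nc_sumE; apply: eq_nc_weight => V _; rewrite addn0. Qed.

Lemma nc_weight_itv r a k m (h : (a + k <= m)%N) :
  nc_weight (fun V : {set 'I_m} => r #|V|) [set x : 'I_m | a <= x < a + k]%N%SET =
  nc_sum r k.
Proof.
rewrite -(imset_shift_ord h) nc_weight_imset; last exact: shift_ord_mono.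
rewrite nc_sumE; apply: eq_nc_weight => V _.
by rewrite card_imset //; exact: shift_ord_inj.
Qed.

Lemma nc_weight_set1 m (phi : {set 'I_m} -> R) x :
  nc_weight phi [set x]%SET = phi [set x]%SET.
Proof.
rewrite /nc_weight (big_pred1 [set [set x]]%SET) ?big_set1 // => p.
rewrite !inE; apply/idP/eqP => [/andP[/partitionsP[h1 h2 h3 h4] _]|->].
  have E V : V \in p -> V = [set x]%SET.
    move=> Vp; have [y yV] := h4 _ Vp.
    apply/eqP; rewrite finset.eqEsubset h1 //= finset.sub1set.
    by have /fintype.subsetP/(_ _ yV) := h1 _ Vp; rewrite inE => /eqP <-.
  apply/setP => V; rewrite inE; apply/idP/eqP => [/E //|->].
  by have [|W Wp _] := h2 x; [rewrite inE|rewrite -(E _ Wp)].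
apply/andP; split; first (apply/partitionsP; split).
- by move=> V /set1P->.
- by move=> y yx; exists [set x]%SET; rewrite ?inE in yx *.
- by move=> V W y /set1P-> /set1P->.
- by move=> V /set1P->; exists x; rewrite inE.
by apply/noncrossingP => V W a b c d /set1P-> /set1P->.
Qed.

(** The successor of the point 0 within its block is the point [i.+1], which is [lift ord0 i]. *)
Definition next_in n (p : {set {set 'I_n.+1}}) (i : 'I_n) : bool :=
  (lift ord0 i \in finset.pblock p ord0) &&
  [forall x : 'I_n.+1, (0 < x < i.+1)%N ==> (x \notin finset.pblock p ord0)].

(** The case distinction on the first block is phrased as a partition of unity, so that it can be
    inserted as a factor and distributed over the sum. *)
Lemma sum_next_in n (p : {set {set 'I_n.+1}}) : p \in NC n.+1 ->
  (finset.pblock p ord0 == [set ord0]%SET)%:R + \sum_i (next_in p i)%:R = 1 :> R.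
Proof.
rewrite inE => /andP[pp _]; have [h1 h2 h3 h4] := partitionsP _ _ pp.
have tp : finset.trivIset p by case/and3P: pp.
have [|V Vp oV] := h2 ord0; first by rewrite inE.
rewrite /next_in (def_pblock tp Vp oV).
have [VE|VN] := eqVneq V [set ord0]%SET.
  rewrite big1 ?addr0 // => i _; rewrite VE inE.
  by rewrite eq_sym (negbTE (neq_lift _ _)).
rewrite add0r.
have [i iV] : exists i : 'I_n, lift ord0 i \in V.
  apply/existsP; apply: contraNT VN => /existsPn h; apply/eqP/setP => x.
  rewrite inE; apply/idP/eqP => [xV|->//].
  by case: (unliftP ord0 x) xV => [y ->|//]; rewrite (negbTE (h y)).
pose j := [arg min_(j < i | lift ord0 j \in V) j : nat].
have [jV jmin] : lift ord0 j \in V /\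
    forall y : 'I_n, lift ord0 y \in V -> (j <= y)%N.
  by rewrite /j; case: arg_minnP => // k kV kmin; split.
rewrite (bigD1 j) //= jV /=.
rewrite (_ : [forall x, _]) ?big1 ?addr0 //.
- move=> k kj; have [kV|//] := boolP (lift ord0 k \in V).
  rewrite (_ : [forall x, _] = false) //; apply/negbTE/negP.
  move=> /forallP/(_ (lift ord0 j)); rewrite lift0 /= jV implybF ltnS -leqNgt => kj'.
  by move/eqP: kj; apply; apply/val_inj/eqP; rewrite eqn_leq jmin // andbT.
- apply/forallP => x; apply/implyP => /andP[x0 xj]; apply/negP => xV.
  case: (unliftP ord0 x) x0 xj xV => [y ->|->//]; rewrite lift0 ltnS => _ yj.
  by move/jmin; move: yj; lia.
Qed.

(* The block of the first point either is a singleton or has a second point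
   [i.+1], which separates the points [1 .. i] from the remaining ones. *)
Lemma nc_sum_first_rec r j n : nc_sum_first r j n =
  r j.+1 * nc_sum r n + \sum_(i < n) nc_sum r i * nc_sum_first r j.+1 (n - i.+1).
Proof.
pose phi (V : {set 'I_n.+1}) := r (#|V| + j * (ord0 \in V))%N.
have -> : nc_sum_first r j n = \sum_(p in NC n.+1)
    ((finset.pblock p ord0 == [set ord0]%SET)%:R + \sum_i (next_in p i)%:R) *
    \prod_(V in p) phi V.
  by apply: eq_bigr => p /sum_next_in ->; rewrite mul1r.
under eq_bigr do rewrite mulrDl mulr_suml.
rewrite big_split exchange_big /=; congr (_ + _).
  pose B := [set x : 'I_n.+1 | 1 <= x < 1 + n]%N%SET.
  have TE : [set: 'I_n.+1]%SET = ([set ord0] :|: B)%SET.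
    by apply/setP => x; rewrite !inE add1n ltn_ord andbT lt0n orbN.
  transitivity (nc_weight phi [set ord0]%SET * nc_weight phi B).
    rewrite -nc_weightU; last 2 first.
    - apply/pred0P => x /=; rewrite !inE; case: eqP => //= ->; by [].
    - by move=> a b c /set1P-> _ /set1P->; rewrite ltn0 andbF.
    rewrite big_mkcondr -TE; apply: eq_bigr => p; rewrite inE => /andP[pp _].
    have [h1 h2 h3 h4] := partitionsP _ _ pp.
    have tp : finset.trivIset p by case/and3P: pp.
    have [|V Vp oV] := h2 ord0; first by rewrite inE.
    rewrite (def_pblock tp Vp oV).
    have -> : (V == [set ord0]%SET) = splits [set ord0]%SET B p.
      apply/eqP/forall_inP => [VE W Wp|/(_ _ Vp)/orP[Vo|/fintype.subsetP/(_ _ oV)]].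
      - have [oW|oW] := boolP (ord0 \in W).
          by rewrite (h3 W V ord0) // VE fintype.subxx.
        apply/orP; right; apply/fintype.subsetP => x xW.
        rewrite inE add1n ltn_ord andbT lt0n.
        by apply: contraNneq oW => x0; rewrite (_ : ord0 = x) //; exact: val_inj.
      - by apply/eqP; rewrite finset.eqEsubset Vo finset.sub1set.
      - by rewrite inE.
    by case: ifP; rewrite ?mul1r ?mul0r.
  rewrite nc_weight_set1 /phi cards1 inE eqxx muln1 add1n; congr (_ * _).
  rewrite -(nc_weight_itv r (leqnn (1 + n))); apply: eq_nc_weight => V VB.
  rewrite (_ : (ord0 \in V) = false) ?muln0 ?addn0 //; apply/negbTE/negP.
  by move/fintype.subsetP: VB => VB /VB; rewrite inE.
apply: eq_bigr => i _.
pose A := [set x : 'I_n.+1 | 1 <= x < 1 + i]%N%SET.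
pose B := [set x : 'I_n.+1 | i.+1 <= x < i.+1 + (n - i.+1).+1]%N%SET.
have iBn : (i.+1 + (n - i.+1).+1 = n.+1)%N by rewrite addnS subnKC.
(* The indicator makes the condition that 0 and [i.+1] share a block multiplicative over blocks, as
   [nc_weightU] and [nc_weight_adjoin] require. *)
pose phi' V := phi V * ((ord0 \in V) ==> (lift ord0 i \in V))%:R.
have TE : [set: 'I_n.+1]%SET = (A :|: (ord0 |: B))%SET.
  apply/setP => x; rewrite !inE iBn ltn_ord andbT add1n.
  rewrite -(inj_eq val_inj) /=; case: (nat_of_ord x) => [|y] //=.
  by rewrite !ltnS ltnNge orNb.
have iB : lift ord0 i \in B by rewrite inE iBn ltn_ord lift0 leqnn.
transitivity (nc_weight phi' A * nc_weight phi' (ord0 |: B)%SET).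
  rewrite -nc_weightU; last 2 first.
  - apply/pred0P => x /=; rewrite !inE -(inj_eq val_inj) /= add1n.
    lia.
  - move=> a b c; rewrite !inE => _ /orP[/eqP->|/andP[ib _]].
      by rewrite ltn0.
    rewrite add1n => /andP[_ ci]; apply/negP => /andP[_ bc].
    by move: (ltn_trans bc ci); rewrite ltnNge ib.
  rewrite big_mkcondr -TE; apply: eq_bigr => p; rewrite inE => /andP[pp /noncrossingP nc].
  have [h1 h2 h3 h4] := partitionsP _ _ pp.
  have tp : finset.trivIset p by case/and3P: pp.
  have [|V Vp oV] := h2 ord0; first by rewrite inE.
  have notA : ord0 \notin A by rewrite inE.
  case: ifP => sp; last first.
    (* If [i.+1] follows 0 in its block, no block meets both sides: one with [y] in [A] and [z]
       outside either contains 0 or [i.+1], or crosses the first block in 0 < y < i.+1 < z. *)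
    rewrite (_ : next_in p i = false) ?mul0r //; apply/negbTE; apply: contraFN sp.
    rewrite /next_in (def_pblock tp Vp oV) => /andP[iV /forallP noA].
    apply/forall_inP => W Wp; have [WA|] := boolP (W \subset A) => //=.
    move=> /subsetPn[z zW zA]; apply/fintype.subsetP => y yW.
    have : y \in [set: 'I_n.+1]%SET by rewrite inE.
    rewrite TE inE => /orP[yA|//]; exfalso.
    have y0i : (0 < y < i.+1)%N by move: yA; rewrite inE add1n.
    have yV : y \notin V by have := noA y; rewrite y0i.
    have VW : V != W by apply: contraNneq yV => ->.
    have : z \in [set: 'I_n.+1]%SET by rewrite inE.
    rewrite TE inE (negbTE zA) /= !inE => /orP[/eqP z0|/andP[iz _]].
      by move/eqP: VW; apply; apply: (h3 _ _ ord0) => //; rewrite -z0.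
    move: iz; rewrite leq_eqVlt => /orP[/eqP iz|iz].
      move/eqP: VW; apply; apply: (h3 _ _ (lift ord0 i)) => //.
      by rewrite (_ : lift ord0 i = z) //; apply: ord_inj; rewrite lift0.
    move/eqP: VW; apply; case/andP: y0i => y0 yi.
    by apply: (nc _ _ ord0 y (lift ord0 i) z); rewrite ?lift0.
  have VB : V \subset (ord0 |: B)%SET.
    move/forall_inP/(_ _ Vp): sp => /orP[/fintype.subsetP/(_ _ oV)|//].
    by rewrite (negbTE notA).
  rewrite /next_in (def_pblock tp Vp oV).
  rewrite (_ : [forall x, _]); last first.
    apply/forallP => x; apply/implyP => /andP[x0 xi]; apply/negP => xV.
    move/fintype.subsetP/(_ _ xV): VB; rewrite !inE (leqNgt i.+1) xi orbF.
    by move/eqP => xE; rewrite xE in x0.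
  rewrite andbT [RHS](bigD1 V) //= [in LHS](bigD1 V) //= /phi' oV /= mulrCA mulrA.
  congr (_ * _); apply: eq_bigr => W /andP[Wp WV].
  rewrite (_ : ord0 \in W = false) ?mulr1 //; apply/negbTE.
  by apply: contraNN WV => oW; apply/eqP; exact: (h3 _ _ ord0).
congr (_ * _).
  have h1i : (1 + i <= n.+1)%N by rewrite add1n ltnS ltnW.
  rewrite -(nc_weight_itv r h1i); apply: eq_nc_weight => V VA.
  rewrite /phi' /phi (_ : (ord0 \in V) = false) ?muln0 ?addn0 ?mulr1 //.
  by apply/negbTE/negP; move/fintype.subsetP: VA => VA /VA; rewrite inE.
(* Removing 0 makes [i.+1] the first point of what remains, with one more peeled point in its block:
   [j] becomes [j.+1]. *)
rewrite (nc_weight_adjoin iB) //; last 2 first.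
- by move=> x; rewrite inE lift0 => /andP[].
- by move=> V oV iV; rewrite /phi' oV (negbTE iV) mulr0.
have hB : (i.+1 + (n - i.+1).+1 <= n.+1)%N by rewrite iBn.
rewrite /B -(imset_shift_ord hB) nc_weight_imset; last exact: shift_ord_mono.
apply: eq_nc_weight => V _.
have sinj := @shift_ord_inj _ _ _ hB.
have liE : lift ord0 i = shift_ord hB ord0 by apply: ord_inj; rewrite lift0 /= addn0.
have oV : ord0 \notin (shift_ord hB @: V)%SET.
  by apply/imsetP => -[x _ /(congr1 val)].
rewrite liE mem_imset //; case: ifP => o_V; last first.
  by rewrite /phi' /phi (negbTE oV) !muln0 !addn0 mulr1 card_imset.
rewrite /phi' /phi (_ : (_ ==> _)) ?mulr1; last first.
  by rewrite liE !finset.in_setU mem_imset // o_V !orbT implybT.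
rewrite finset.in_setU1 eqxx /=.
by rewrite cardsU1 oV card_imset // !muln1 add1n addnS.
Qed.

End NoncrossingRecursion.

Lemma nc_sum_0 (R : realType) (r : nat -> R) : nc_sum r 0 = 1.
Proof.
rewrite /nc_sum (big_pred1 finset.set0) ?big_set0 // => p; rewrite inE.
apply/idP/eqP => [/andP[/partitionsP[_ _ _ h4] _]|->].
  by apply/setP => V; rewrite inE; apply/negbTE/negP => /h4[[]].
apply/andP; split; last by apply/noncrossingP => V W a b c d; rewrite inE.
by apply/partitionsP; split=> [V|[]//|V W x|V]; rewrite inE.
Qed.

(** * Formal power series *)

Section FormalPowerSeries.
Variable A : comNzRingType.

(** The coefficient ring is kept general because [shifted_composition] uses series whose
    coefficients are themselves series. *)
Definition fps := nat -> A.

HB.instance Definition _ := GRing.Zmodule.on fps.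

Implicit Types f g h : fps.

Definition fps_mul f g : fps := fun n => \sum_(i < n.+1) f i * g (n - i)%N.
Definition fps_one : fps := fun n => (n == 0%N)%:R.

(** Transports associativity and commutativity from polynomial truncations. *)
Lemma fps_mulE f g N n : (n < N)%N ->
  fps_mul f g n = ((\poly_(i < N) f i) * (\poly_(i < N) g i))`_n.
Proof.
move=> nN; rewrite coefM; apply: eq_bigr => i _; rewrite !coef_poly.
by rewrite (leq_ltn_trans _ nN) ?leq_ord // (leq_ltn_trans _ nN) ?leq_subr.
Qed.

Lemma fps_mulC : commutative fps_mul.
Proof.
by move=> f g; apply/funext => n; rewrite !(fps_mulE _ _ (ltnSn n)) mulrC.
Qed.

Lemma fps_mulA : associative fps_mul.
Proof.
move=> f g h; apply/funext => n.
transitivity (((\poly_(i < n.+1) f i) * ((\poly_(i < n.+1) g i) *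
    (\poly_(i < n.+1) h i)))`_n).
  rewrite coefM; apply: eq_bigr => i _; rewrite coef_poly ltn_ord; congr (_ * _).
  by rewrite (@fps_mulE _ _ n.+1) // ltnS leq_subr.
rewrite mulrA coefM; apply: eq_bigr => i _.
by rewrite [in X in _ * X]coef_poly ltnS leq_subr -fps_mulE.
Qed.

Lemma fps_mul1 : left_id fps_one fps_mul.
Proof.
move=> f; apply/funext => n; rewrite /fps_mul big_ord_recl /= subn0 mul1r.
by rewrite big1 ?addr0 // => i _; rewrite mul0r.
Qed.

Lemma fps_mulDl : left_distributive fps_mul +%R.
Proof.
move=> f g h; apply/funext => n; rewrite [RHS]/GRing.add /= -big_split /=.
by apply: eq_bigr => i _; rewrite -mulrDl.
Qed.

Lemma fps_oner_neq0 : fps_one != 0.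
Proof. by apply/eqP => /(congr1 (@^~ 0%N)) /eqP; rewrite oner_eq0. Qed.

HB.instance Definition _ := GRing.Zmodule_isComNzRing.Build fps
  fps_mulA fps_mulC fps_mul1 fps_mulDl fps_oner_neq0.

Definition fpsC (a : A) : fps := fun n => a *+ (n == 0%N).
Definition fpsX : fps := fun n => (n == 1%N)%:R.

Lemma fpsD f g n : (f + g) n = f n + g n.
Proof. by []. Qed.

Lemma fps1E n : (1 : fps) n = (n == 0%N)%:R.
Proof. by []. Qed.

Lemma fpsM f g n : (f * g) n = \sum_(i < n.+1) f i * g (n - i)%N.
Proof. by []. Qed.

Lemma fpsCM a f n : (fpsC a * f) n = a * f n.
Proof.
rewrite fpsM big_ord_recl /= subn0 big1 ?addr0 // => i _.
by rewrite /fpsC /= mulr0n mul0r.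
Qed.

Lemma fpsXM0 f : (fpsX * f) 0%N = 0.
Proof. by rewrite fpsM big_ord1 mul0r. Qed.

Lemma fpsXMS f n : (fpsX * f) n.+1 = f n.
Proof.
rewrite fpsM big_ord_recl /= mul0r add0r big_ord_recl /= mul1r.
by rewrite big1 ?addr0 ?subSS ?subn0 // => i _; rewrite mul0r.
Qed.

Lemma fpsC_is_additive : zmod_morphism fpsC.
Proof. by move=> a b; apply/funext => n; rewrite /fpsC mulrnBl. Qed.

Lemma fpsC_is_monoid_morphism : monoid_morphism fpsC.
Proof.
split; first by apply/funext.
by move=> a b; apply/funext => n; rewrite fpsCM /fpsC mulrnAr.
Qed.

HB.instance Definition _ := GRing.isZmodMorphism.Build A fps fpsC fpsC_is_additive.
HB.instance Definition _ :=
  GRing.isMonoidMorphism.Build A fps fpsC fpsC_is_monoid_morphism.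

Definition fps_agree (n : nat) f g := forall i, (i < n)%N -> f i = g i.

Lemma fps_agreeM n f f' g g' :
  fps_agree n f f' -> fps_agree n g g' -> fps_agree n (f * g) (f' * g').
Proof.
move=> ff gg i ni; rewrite !fpsM; apply: eq_bigr => j _.
by rewrite ff ?gg // (leq_ltn_trans _ ni) ?leq_subr // leq_ord.
Qed.

Lemma fps_agreeD n f f' g g' :
  fps_agree n f f' -> fps_agree n g g' -> fps_agree n (f + g) (f' + g').
Proof. by move=> ff gg i ni; rewrite !fpsD ff ?gg. Qed.

Lemma fps_agreeX n f f' :
  fps_agree n f f' -> fps_agree n.+1 (fpsX * f) (fpsX * f').
Proof. by move=> ff [|i] ni; rewrite ?fpsXM0 // !fpsXMS ff. Qed.

Definition fps_contractive (Phi : fps -> fps) :=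
  forall n f g, fps_agree n f g -> fps_agree n.+1 (Phi f) (Phi g).

(** Banach iteration in the adic topology: the coefficient of order [n] is final after [n.+1]
    iterations, so the limit is read off the diagonal. *)
Lemma fps_fixpoint Phi : fps_contractive Phi -> exists f : fps, f = Phi f.
Proof.
move=> ctr; pose u n := iter n Phi 0; pose f : fps := fun n => u n.+1 n.
have uS n k : fps_agree n (u n) (u (n + k)%N).
  elim: n => [//|n IHn]; rewrite addSn; exact: ctr.
have fu n : fps_agree n f (u n).
  by move=> i ni; rewrite /f (uS i.+1 (n - i.+1)%N) // subnKC.
exists f; apply/funext => n.
by rewrite (fu n.+1) //=; symmetry; apply: (ctr n) => // i ni; exact: fu.
Qed.

End FormalPowerSeries.
Arguments fpsX {A}.

(** * Free cumulants of the tail-constant model *)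

Section Motzkin.
Variable R : comNzRingType.
Implicit Types beta gamma : nat -> R.

(* The generating function of Motzkin paths of length [n] from height [k] to
   height 0, with weights [beta] for level steps and [gamma] for falls; it is
   the integral of [x ^+ n * P k] against any measure with these Jacobi
   parameters. *)
Fixpoint motzkin beta gamma (n k : nat) : R :=
  if n is n'.+1 then
    motzkin beta gamma n' k.+1 + beta k * motzkin beta gamma n' k +
    (if k is k'.+1 then gamma k' * motzkin beta gamma n' k' else 0)
  else (k == 0%N)%:R.

Lemma eq_motzkin beta gamma beta' gamma' : beta =1 beta' -> gamma =1 gamma' ->
  motzkin beta gamma =2 motzkin beta' gamma'.
Proof.
move=> bb gg; elim=> [//|n IHn] k /=; rewrite !IHn bb; congr (_ + _).
by case: k => // k; rewrite gg IHn.
Qed.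

Definition head_tail (a b : R) (m : nat) : R := if m == 0%N then a else b.

(** Cut a path from height [k] at its first visits to k-1, ..., 0. Each piece above height 0
    contributes [T] and a fall contributes z times its gamma, while the final piece, starting at
    height 0, contributes [S]. The proof checks that this product satisfies the Motzkin
    recursion. *)
Lemma motzkin_fps (b0 b1 g0 g1 : R) (S T : fps R) n k :
  T = 1 + fpsX * (fpsC b1 * T + fpsC g1 * (fpsX * (T * T))) ->
  S = 1 + fpsX * (fpsC b0 * S + fpsC g0 * (fpsX * (T * S))) ->
  motzkin (head_tail b0 b1) (head_tail g0 g1) n k =
  (if k is k'.+1 then fpsC g0 * fpsC g1 ^+ k' * S * (fpsX * T) ^+ k'.+1 else S) n.
Proof.
move=> TE SE.
set N := fun k => if k is k'.+1
  then fpsC g0 * fpsC g1 ^+ k' * S * (fpsX * T) ^+ k'.+1 else S.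
rewrite -/(N k).
have NE i : N i = (i == 0%N)%:R + fpsX * (N i.+1 + fpsC (head_tail b0 b1 i) * N i +
    (if i is i'.+1 then fpsC (head_tail g0 g1 i') * N i' else 0)).
  case: i => [|[|i]] /=; rewrite /head_tail /=.
  - rewrite {1}SE expr0 expr1 mulr1; ring.
  - by rewrite !expr1 expr0 add0r [in LHS]TE expr2; ring.
  - set U := 1 + fpsX * (fpsC b1 * T + fpsC g1 * (fpsX * (T * T))) in TE.
    apply/eqP; rewrite -subr_eq0 (_ : _ - _ =
      fpsC g0 * fpsC g1 ^+ i.+1 * S * (fpsX * T) ^+ i.+1 * fpsX * (T - U)).
      by rewrite -TE subrr mulr0.
    by rewrite /U !exprS; ring.
elim: n k => [|n IHn] k; rewrite NE fpsD.
  by rewrite fpsXM0 addr0; case: k.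
have -> : ((k == 0%N)%:R : fps R) n.+1 = 0 by case: (k == 0%N).
rewrite fpsXMS !fpsD fpsCM add0r /= !IHn; congr (_ + _ + _).
by case: k => [//|k]; rewrite fpsCM IHn.
Qed.

Lemma semicircle_fps_exists (b c : R) : exists T : fps R,
  T = 1 + fpsX * (fpsC b * T + fpsC c * (fpsX * (T * T))).
Proof.
apply: fps_fixpoint => n f g fg; apply: fps_agreeD => //.
apply: fps_agreeX; apply: fps_agreeD; apply: fps_agreeM => //.
by move=> i ni; apply: (fps_agreeX (fps_agreeM fg fg)); exact: leqW.
Qed.

Lemma meixner_fps_exists (b c : R) (T : fps R) : exists S : fps R,
  S = 1 + fpsX * (fpsC b * S + fpsC c * (fpsX * (T * S))).
Proof.
apply: fps_fixpoint => n f g fg; apply: fps_agreeD => //.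
apply: fps_agreeX; apply: fps_agreeD; apply: fps_agreeM => //.
by move=> i ni; apply: (fps_agreeX (@fps_agreeM _ n T T _ _ _ fg)) => //; exact: leqW.
Qed.

Lemma motzkin_semicircle (b c : R) (T : fps R) n :
  T = 1 + fpsX * (fpsC b * T + fpsC c * (fpsX * (T * T))) ->
  motzkin (fun=> b) (fun=> c) n 0 = T n.
Proof.
move=> TE; rewrite -(motzkin_fps n 0 TE TE).
by apply: eq_motzkin => i; rewrite /head_tail; case: ifP.
Qed.

End Motzkin.

Section MeixnerCumulants.
Variable R : realType.

Definition meixner_cumulant (b0 g0 b c : R) (k : nat) : R :=
  match k with
  | 0 => 0
  | 1 => b0
  | k'.+2 => g0 * motzkin (fun=> b) (fun=> c) k' 0
  end.

(* With [w = zS], the series [Y k] is the [k]-fold shift of the semicircular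
   moment series composed with [w]; the identity [Y 0 = T / S] is what makes the
   free Meixner moment series solve the moment-cumulant equation. *)
Lemma shifted_composition (b c : R) (sg w X : fps R) :
  sg = 1 + fpsX * (fpsC b * sg + fpsC c * (fpsX * (sg * sg))) ->
  X = 1 + w * (fpsC b * X + fpsC c * (w * (X * X))) ->
  exists Y : nat -> fps R,
    Y 0%N = X /\ forall k, Y k = fpsC (sg k) + w * Y k.+1.
Proof.
move=> sgE XE.
pose sgC : fps (fps R) := fun n => fpsC (sg n).
(* The outer variable indexes the shifts. Shifting the equation of [sg] gives Y_{k+1} = b Y_k + c
   (shift of z sg^2), and by the product rule for shifts that last shift is [Z k + w * X * Y k],
   with [Z] as below. *)
pose Phi (Y : fps (fps R)) : fps (fps R) := fpsC X +
  fpsX * (fpsC (fpsC b) * Y + fpsC (fpsC c) * (fpsX * (sgC * Y)) +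
          fpsC (fpsC c * w * X) * Y).
have [|Y YE] := @fps_fixpoint _ Phi.
  move=> n f g fg; apply: fps_agreeD => //; apply: fps_agreeX.
  apply: fps_agreeD; last by apply: fps_agreeM.
  apply: fps_agreeD; apply: fps_agreeM => //.
  by move=> i ni; apply: (fps_agreeX (@fps_agreeM _ n _ _ f g _ fg)) => //; exact: leqW.
pose Z : fps (fps R) := fpsX * (sgC * Y).
pose z : fps R := fpsX * (sg * sg).
have Y0 : Y 0%N = X by rewrite YE /Phi fpsD fpsXM0 addr0 /fpsC eqxx.
have YS k : Y k.+1 = fpsC b * Y k + fpsC c * Z k + fpsC c * w * X * Y k.
  by rewrite {1}YE /Phi fpsD fpsXMS !fpsD !fpsCM /= /fpsC /= mulr0n add0r.
have sgS k : sg k.+1 = b * sg k + c * z k.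
  by rewrite {1}sgE fpsD fpsXMS fpsD !fpsCM fps1E add0r.
have sg0 : sg 0%N = 1 by rewrite sgE fpsD fpsXM0 fps1E addr0.
have key k : forall i, (i <= k)%N -> Y i = fpsC (sg i) + w * Y i.+1.
  elim: k => [|k IHk] i.
    rewrite leqn0 => /eqP->; rewrite YS /Z fpsXM0 Y0 sg0 rmorph1 {1}XE; ring.
  rewrite leq_eqVlt => /orP[/eqP->|]; last exact: IHk.
  (* The induction hypothesis applied to each term of the convolution; this is why [key] covers all
     indices up to [k]. *)
  have Zrec : w * Z k.+1 = Z k - fpsC (z k) + w * fpsC (sg k) * X.
    rewrite /Z fpsXMS fpsM big_ord_recr /= subnn Y0 mulrDr.
    congr (_ + _); last by rewrite mulrA.
    rewrite /z; case: k IHk => [|k] IHk.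
      by rewrite big_ord0 mulr0 !fpsXM0 rmorph0 subr0.
    rewrite !fpsXMS !fpsM rmorph_sum -sumrB mulr_sumr; apply: eq_bigr => j _.
    rewrite rmorphM -mulrBr mulrCA; congr (_ * _).
    rewrite (IHk (k - j)%N) ?(leq_trans (leq_subr _ _)) //.
    by rewrite subSn -1?ltnS // addrAC subrr add0r.
  rewrite [in LHS]YS sgS [in RHS]YS !mulrDr.
  have -> : w * (fpsC c * Z k.+1) = fpsC c * (w * Z k.+1) by ring.
  rewrite Zrec rmorphD !rmorphM.
  have YE' := IHk k (leqnn k); rewrite -/fpsC in YE' *.
  rewrite {1 2}YE'; ring.
by exists Y; split=> // k; exact: (key k).
Qed.

(** Guess and verify: [nc_sum_first_rec] determines all the sums order by order, so it suffices to
    exhibit series satisfying the same recursion. *)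
Lemma nc_sum_meixner (b0 g0 b c t : R) n :
  nc_sum (fun k => t * meixner_cumulant b0 g0 b c k) n =
  motzkin (head_tail (b0 * t) (b + b0 * t)) (head_tail (g0 * t) (c + g0 * t)) n 0.
Proof.
set r := fun k => _.
have [sg sgE] := semicircle_fps_exists b c.
have [T TE] := semicircle_fps_exists (b + b0 * t) (c + g0 * t).
have [S SE] := meixner_fps_exists (b0 * t) (g0 * t) T.
pose X := 1 + fpsX * (fpsC b * T + fpsC c * (fpsX * (T * T))).
have SX : S * X = T.
  (* [U] is the inverse of [S]; it yields X = T / S without division of series. *)
  pose U : fps R := 1 - fpsX * (fpsC (b0 * t) + fpsC (g0 * t) * (fpsX * T)).
  have SU : S * U = 1.
    have -> : S * U = S - fpsX * (fpsC (b0 * t) * S + fpsC (g0 * t) * (fpsX * (T * S))).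
      by rewrite /U; ring.
    by rewrite {1}SE addrK.
  have TU : T * U = X.
    have -> : T * U = T - fpsX * (fpsC (b0 * t) * T + fpsC (g0 * t) * (fpsX * (T * T))).
      by rewrite /U; ring.
    by rewrite {1}TE /X !rmorphD; ring.
  by rewrite -TU mulrCA SU mulr1.
have XE : X = 1 + (fpsX * S) * (fpsC b * X + fpsC c * ((fpsX * S) * (X * X))).
  rewrite {1}/X -{1 2 3}SX; ring.
have [Y [Y0 YS]] := shifted_composition sgE XE.
(* Candidate generating series of [nc_sum_first r j]. From order 2 on the cumulants are g0 t times
   the semicircular moments, so the tail from [j.+1] is the same multiple of [S * Y j]. *)
pose F (j : nat) : fps R := if j is j'.+1 then fpsC (g0 * t) * S * Y j'
  else fpsC (b0 * t) * S + fpsX * (S * (fpsC (g0 * t) * S * Y 0%N)).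
have FE j : F j = fpsC (r j.+1) * S + fpsX * (S * F j.+1).
  case: j => [|j] /=; first by rewrite /r /= [t * _]mulrC.
  rewrite {1}(YS j) /r /= (motzkin_semicircle _ sgE).
  have -> : t * (g0 * sg j) = (g0 * t) * sg j by rewrite mulrCA mulrA.
  rewrite (rmorphM (@fpsC R)) /=; ring.
have SF : S = 1 + fpsX * F 0%N.
  by rewrite {1}SE /F Y0 -{1}SX; ring.
have key N : (forall i, (i <= N)%N -> nc_sum r i = S i) /\
    forall j i, (i < N)%N -> nc_sum_first r j i = F j i.
  elim: N => [|N [IHS IHF]].
    split=> // i; rewrite leqn0 => /eqP->.
    by rewrite nc_sum_0 SF fpsD fpsXM0 fps1E addr0.
  have FN j : nc_sum_first r j N = F j N.
    rewrite nc_sum_first_rec FE fpsD fpsCM IHS //; congr (_ + _).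
    case: N IHS IHF => [|N] IHS IHF; first by rewrite big_ord0 fpsXM0.
    rewrite fpsXMS fpsM; apply: eq_bigr => i _.
    by rewrite IHS ?IHF ?subSS // ?ltnS ?leq_subr // -ltnS ltnW // ltnS.
  split=> [i|j i].
    rewrite leq_eqVlt => /orP[/eqP->|]; last exact: IHS.
    by rewrite nc_sum_firstE FN [in RHS]SF fpsD fpsXMS fps1E add0r.
  by rewrite ltnS leq_eqVlt => /orP[/eqP->//|]; exact: IHF.
by rewrite (motzkin_fps n 0 TE SE) (proj1 (key n)).
Qed.

End MeixnerCumulants.

(** * Moments and Jacobi parameters *)

Section MotzkinParameters.
Variable R : realType.
Implicit Types beta gamma : nat -> R.

Lemma motzkin_gt beta gamma n k : (n < k)%N -> motzkin beta gamma n k = 0.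
Proof.
elim: n k => [|n IHn] [|k] //= nk.
by rewrite !IHn ?mulr0 ?addr0 //; lia.
Qed.

Lemma motzkin_diag beta gamma k :
  motzkin beta gamma k k = \prod_(i < k) gamma i.
Proof.
elim: k => [|k IHk]; first by rewrite big_ord0.
rewrite /= (@motzkin_gt _ _ k k.+2) // (@motzkin_gt _ _ k k.+1) // IHk.
by rewrite big_ord_recr /= mulr0 !add0r mulrC.
Qed.

Section Agree.
Variables (beta gamma beta' gamma' : nat -> R) (m : nat).
Hypothesis agree : forall i, (i < m)%N -> beta i = beta' i /\ gamma i = gamma' i.

(** A path of length [n] from height [k] to 0 never rises above (n + k) / 2. A level step at height
    [m] requires n + k > 2m, and a fall from height m + 1 requires n + k > 2m + 1. *)
Lemma motzkin_agree n k : (n + k <= m.*2)%N ->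
  motzkin beta gamma n k = motzkin beta' gamma' n k.
Proof.
elim: n k => [//|n IHn] k nk /=; rewrite IHn; last lia.
congr (_ + _ + _).
  have [/agree[-> _]|mk] := ltnP k m; first by rewrite IHn //; lia.
  by rewrite !motzkin_gt ?mulr0 //; lia.
case: k nk => // k nk.
have [/agree[_ ->]|mk] := ltnP k m; first by rewrite IHn //; lia.
by rewrite !motzkin_gt ?mulr0 //; lia.
Qed.

(** A single path sees [beta m]: straight up to height [m], one level step, straight down. *)
Lemma motzkin_beta n k : (n + k = m.*2.+1)%N -> (k <= m)%N ->
  motzkin beta gamma n k - motzkin beta' gamma' n k =
  (beta m - beta' m) * \prod_(i < m) gamma i.
Proof.
elim: n k => [|n IHn] k nk km; first lia.
have <- : motzkin beta gamma m m = \prod_(i < m) gamma i by exact: motzkin_diag.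
rewrite /=; have -> : (if k is k'.+1 then gamma k' * motzkin beta gamma n k' else 0) =
    (if k is k'.+1 then gamma' k' * motzkin beta' gamma' n k' else 0).
  case: k nk km => // k nk km; rewrite (proj2 (agree km)).
  by rewrite motzkin_agree //; lia.
rewrite opprD addrACA subrr addr0.
move: km; rewrite leq_eqVlt => /orP[/eqP kE|km].
  have -> : n = m by lia.
  rewrite kE !(@motzkin_gt _ _ m m.+1) // -(@motzkin_agree m m) //; last lia.
  ring.
rewrite (proj1 (agree km)) (@motzkin_agree n k); last lia.
rewrite motzkin_diag -(IHn k.+1) //; last lia.
ring.
Qed.

(** A single path sees [gamma m]: straight up to height [m.+1], then straight down. *)
Lemma motzkin_gamma n k : beta m = beta' m ->
  (n + k = m.*2.+2)%N -> (k <= m)%N ->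
  motzkin beta gamma n k - motzkin beta' gamma' n k =
  (gamma m - gamma' m) * \prod_(i < m) gamma i.
Proof.
move=> bm; elim: n k => [|n IHn] k nk km; first lia.
rewrite /=; have -> : (if k is k'.+1 then gamma k' * motzkin beta gamma n k' else 0) =
    (if k is k'.+1 then gamma' k' * motzkin beta' gamma' n k' else 0).
  case: k nk km => // k nk km; rewrite (proj2 (agree km)).
  by rewrite motzkin_agree //; lia.
have -> : beta k * motzkin beta gamma n k = beta' k * motzkin beta' gamma' n k.
  have -> : beta k = beta' k.
    by move: km; rewrite leq_eqVlt => /orP[/eqP->//|/agree[]].
  congr (_ * _); apply/eqP; rewrite -subr_eq0 motzkin_beta ?bm ?subrr ?mul0r //.
  lia.
rewrite opprD addrACA subrr addr0 opprD addrACA subrr addr0.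
move: km; rewrite leq_eqVlt => /orP[/eqP kE|km].
  have -> : n = m.+1 by lia.
  rewrite kE !motzkin_diag !big_ord_recr /=.
  have -> : \prod_(i < m) gamma' i = \prod_(i < m) gamma i.
    by apply: eq_bigr => i _; rewrite (proj2 (agree (ltn_ord i))).
  ring.
by rewrite (IHn k.+1) //; lia.
Qed.

End Agree.

(** Each new parameter enters its moment with the product of the earlier gammas as coefficient,
    which is nonzero in a defined column. The cutoff [N] serves comparisons valid only up to a
    finite order. *)
Lemma motzkin_inj beta gamma beta' gamma' N :
  (forall n, (n <= N)%N -> motzkin beta gamma n 0 = motzkin beta' gamma' n 0) ->
  forall m, jacobi_defined gamma m ->
    ((m.*2.+1 <= N)%N -> beta m = beta' m) /\
    ((m.*2.+2 <= N)%N -> gamma m = gamma' m).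
Proof.
move=> MM; elim/ltn_ind => m IH dm.
have gm : \prod_(i < m) gamma i != 0 by apply/prodf_neq0 => i _; exact: dm.
have agree : (m.*2 <= N)%N ->
    forall i, (i < m)%N -> beta i = beta' i /\ gamma i = gamma' i.
  move=> mN i im; have [|bi gi] := IH i im; first by move=> j ji; apply: dm; lia.
  by split; [apply: bi|apply: gi]; lia.
have bm : (m.*2.+1 <= N)%N -> beta m = beta' m.
  move=> mN; have ag := agree (ltnW mN).
  have := motzkin_beta ag (addn0 _) (leq0n m); rewrite MM // subrr.
  by move/esym/eqP; rewrite mulf_eq0 (negbTE gm) orbF subr_eq0 => /eqP.
split=> // mN; have ag := agree (ltnW (ltnW mN)).
have := motzkin_gamma ag (bm (ltnW mN)) (addn0 _) (leq0n m); rewrite MM // subrr.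
by move/esym/eqP; rewrite mulf_eq0 (negbTE gm) orbF subr_eq0 => /eqP.
Qed.

Lemma motzkin_undefined beta gamma n k i : (i < k)%N -> gamma i = 0 ->
  motzkin beta gamma n k = 0.
Proof.
move=> ik gi; elim: n k ik => [|n IHn] [|k] //= ik.
rewrite (IHn k.+2) ?(IHn k.+1) //; last exact: leqW.
move: ik; rewrite ltnS leq_eqVlt => /orP[/eqP ik|ik].
  by rewrite -ik gi mul0r mulr0 !addr0.
by rewrite IHn // !mulr0 !addr0.
Qed.

(** A disregarded parameter only affects paths that later fall through the first zero gamma. This
    lets [jacobi_tail_constant], a condition on defined columns, be replaced by genuinely constant
    tails. *)
Lemma motzkin_defined_eq beta gamma beta' gamma' :
  (forall m, jacobi_defined gamma m -> beta m = beta' m /\ gamma m = gamma' m) ->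
  motzkin beta gamma =2 motzkin beta' gamma'.
Proof.
move=> E.
have undef k : ~ jacobi_defined gamma k ->
    exists2 i, (i < k)%N & gamma i = 0 /\ gamma' i = 0.
  elim: k => [|k IHk] nk; first by case: nk.
  have [dk|/IHk[i ik gi]] := pselect (jacobi_defined gamma k); last first.
    by exists i => //; exact: leqW.
  exists k => //; suff gk : gamma k = 0 by split=> //; rewrite -(proj2 (E _ dk)).
  apply/eqP/negPn/negP => gk; apply: nk => i.
  by rewrite ltnS leq_eqVlt => /orP[/eqP->//|]; exact: dk.
elim=> [//|n IHn] k.
have [dk|/undef[i ik [gi gi']]] := pselect (jacobi_defined gamma k); last first.
  by rewrite !(motzkin_undefined _ _ ik).
rewrite /= !IHn (proj1 (E _ dk)); congr (_ + _).
case: k dk => // k dk; rewrite (proj2 (E k _)) ?IHn // => i ik.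
by apply: dk; exact: leqW.
Qed.

End MotzkinParameters.

(** * Moment functionals on polynomials *)

Section MomentFunctional.
Variable R : realType.
Implicit Types (s : nat -> R) (p q : {poly R}).

Definition mom_lin s p : R := \sum_(i < size p) p`_i * s i.

Lemma mom_linE s p n : (size p <= n)%N -> mom_lin s p = \sum_(i < n) p`_i * s i.
Proof.
move=> pn; rewrite /mom_lin (big_ord_widen n (fun i => p`_i * s i)) // big_mkcond.
apply: eq_bigr => i _; case: ltnP => // ip.
by rewrite nth_default ?mul0r.
Qed.

Lemma mom_lin_is_linear s : linear_for *%R (mom_lin s).
Proof.
move=> a p q; pose n := maxn (size p) (size q).
have pn : (size p <= n)%N by exact: leq_maxl.
have qn : (size q <= n)%N by exact: leq_maxr.
rewrite (mom_linE _ pn) (mom_linE _ qn) (@mom_linE _ _ n); last first.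
  rewrite (leq_trans (size_polyD _ _)) // geq_max qn andbT.
  exact: leq_trans (size_scale_leq _ _) _.
rewrite mulr_sumr -big_split; apply: eq_bigr => i _ /=.
by rewrite coefD coefZ mulrDl mulrA.
Qed.

HB.instance Definition _ s :=
  GRing.isLinear.Build R {poly R} R *%R (mom_lin s) (mom_lin_is_linear s).

Lemma mom_linXn s n : mom_lin s 'X^n = s n.
Proof.
rewrite /mom_lin size_polyXn big_ord_recr /= coefXn eqxx mul1r.
by rewrite big1 ?add0r // => i _; rewrite coefXn ltn_eqF ?mul0r.
Qed.

Lemma mom_lin1 s : mom_lin s 1 = s 0%N.
Proof. by rewrite -(mom_linXn s 0) expr0. Qed.

Lemma mom_linM s p q :
  mom_lin s (p * q) = \sum_(i < size p) p`_i * mom_lin s ('X^i * q).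
Proof.
rewrite -{1}[p]coefK poly_def mulr_suml linear_sum; apply: eq_bigr => i _.
by rewrite -scalerAl linearZ.
Qed.

End MomentFunctional.

Section PolynomialIntegral.
Variables (R : realType) (mu : probability R R).
Hypothesis fm : finite_moments mu.

Lemma integrable_poly (p : {poly R}) :
  mu.-integrable setT (fun x : R => (p.[x])%:E) /\
  \int[mu]_x p.[x] = mom_lin (moment mu) p.
Proof.
rewrite /mom_lin.
have -> : (fun x : R => p.[x]) = (fun x => \sum_(i < size p) p`_i * x ^+ i).
  by apply/funext => x; rewrite horner_coef.
have -> : (fun x : R => (p.[x])%:E) =
    (fun x => (\sum_(i < size p) p`_i * x ^+ i)%:E).
  by apply/funext => x; rewrite horner_coef.
elim: (size p) => [|n [IH1 IH2]].
  split; first by under eq_fun do rewrite big_ord0; exact: integrable0.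
  by under eq_Rintegral do rewrite big_ord0; rewrite Rintegral_cst// mul0r big_ord0.
have I2 : mu.-integrable setT (fun x : R => (p`_n * x ^+ n)%:E).
  by have := integrableZl measurableT p`_n (fm n); under eq_fun do rewrite -EFinM.
split.
  under eq_fun do rewrite big_ord_recr /= EFinD.
  exact: integrableD.
under eq_Rintegral do rewrite big_ord_recr /=.
rewrite RintegralD // IH2 big_ord_recr /=; congr (_ + _).
rewrite RintegralZl //; exact: fm.
Qed.

Lemma Rintegral_poly (p : {poly R}) : \int[mu]_x p.[x] = mom_lin (moment mu) p.
Proof. by have [] := integrable_poly p. Qed.

Lemma mom_lin_sqr_ge0 (p : {poly R}) : 0 <= mom_lin (moment mu) (p * p).
Proof.
rewrite -Rintegral_poly; apply: Rintegral_ge0 => x _.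
by rewrite hornerM -expr2 sqr_ge0.
Qed.

End PolynomialIntegral.

(** * Orthogonal polynomials from the three-term recurrence *)

Section OrthogonalPolynomials.
Variable R : realType.
Implicit Types beta gamma : nat -> R.

(** Two consecutive polynomials are carried along to make the three-term recurrence structural. *)
Fixpoint orth_pair beta gamma (k : nat) : {poly R} * {poly R} :=
  if k is k'.+1 then
    let: (p, q) := orth_pair beta gamma k' in
    (q, ('X - (beta k)%:P) * q - gamma k' *: p)
  else (1, 'X - (beta 0%N)%:P).

Definition orth_poly beta gamma k := (orth_pair beta gamma k).1.

Lemma orth_poly0 beta gamma : orth_poly beta gamma 0 = 1.
Proof. by []. Qed.

Lemma orth_poly1 beta gamma : orth_poly beta gamma 1 = 'X - (beta 0%N)%:P.
Proof. by []. Qed.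

Lemma orth_polySS beta gamma k : orth_poly beta gamma k.+2 =
  ('X - (beta k.+1)%:P) * orth_poly beta gamma k.+1 -
  gamma k *: orth_poly beta gamma k.
Proof. by rewrite /orth_poly /=; case: (orth_pair beta gamma k). Qed.

Lemma orth_poly_monic beta gamma k :
  orth_poly beta gamma k \is monic /\ size (orth_poly beta gamma k) = k.+1.
Proof.
suff: (orth_poly beta gamma k \is monic /\ size (orth_poly beta gamma k) = k.+1) /\
  (orth_poly beta gamma k.+1 \is monic /\ size (orth_poly beta gamma k.+1) = k.+2).
  by case.
elim: k => [|k [[m1 s1] [m2 s2]]].
  by rewrite orth_poly0 orth_poly1 monic1 size_poly1 monicXsubC size_XsubC.
split=> //; rewrite orth_polySS.
set q := orth_poly beta gamma k.+1 in m2 s2 *.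
have mq : ('X - (beta k.+1)%:P) * q \is monic by rewrite monicMl ?monicXsubC.
have sq : size (('X - (beta k.+1)%:P) * q) = k.+3.
  by rewrite size_monicM ?monicXsubC ?monic_neq0 // size_XsubC s2.
have lt : (size (- (gamma k *: orth_poly beta gamma k))%R
           < size (('X - (beta k.+1)%:P) * q)%R)%N.
  by rewrite size_polyN sq (leq_ltn_trans (size_scale_leq _ _)) // s1.
by rewrite monicE lead_coefDl // -monicE size_polyDl.
Qed.

Lemma mulX_orth_poly beta gamma k : 'X * orth_poly beta gamma k.+1 =
  orth_poly beta gamma k.+2 + beta k.+1 *: orth_poly beta gamma k.+1 +
  gamma k *: orth_poly beta gamma k.
Proof. by rewrite orth_polySS mulrBl mul_polyC addrAC subrK subrK. Qed.

Lemma motzkin_moments (s : nat -> R) beta gamma (P : nat -> {poly R}) :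
  P 0%N = 1 -> 'X * P 0%N = P 1%N + beta 0%N *: P 0%N ->
  (forall m, 'X * P m.+1 = P m.+2 + beta m.+1 *: P m.+1 + gamma m *: P m) ->
  (forall k, mom_lin s (P k) = (k == 0%N)%:R) ->
  forall n k, mom_lin s ('X^n * P k) = motzkin beta gamma n k.
Proof.
move=> P0 P1 PS sP; elim=> [|n IHn] k; first by rewrite mul1r sP.
rewrite exprSr -mulrA; case: k => [|k].
  by rewrite P1 mulrDr -scalerAr linearD linearZ /= !IHn addr0.
by rewrite PS !mulrDr -!scalerAr !linearD !linearZ /= !IHn.
Qed.

Lemma mom_lin_orth_poly beta gamma n k :
  mom_lin (fun i => motzkin beta gamma i 0) ('X^n * orth_poly beta gamma k) =
  motzkin beta gamma n k.
Proof.
suff H : (forall n, mom_lin (fun i => motzkin beta gamma i 0)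
    ('X^n * orth_poly beta gamma k) = motzkin beta gamma n k) /\
  (forall n, mom_lin (fun i => motzkin beta gamma i 0)
    ('X^n * orth_poly beta gamma k.+1) = motzkin beta gamma n k.+1).
  by case: H.
elim: k {n} => [|k [IH1 IH2]].
  split=> n; first by rewrite orth_poly0 mulr1 mom_linXn.
  rewrite orth_poly1 mulrBr -exprSr mulrC mul_polyC linearB linearZ /= !mom_linXn /=.
  by rewrite addr0 addrK.
split=> // n; rewrite orth_polySS mulrBr mulrA mulrBr -exprSr mulrBl.
rewrite (mulrC _ (beta k.+1)%:P) mul_polyC -scalerAl -scalerAr.
by rewrite !linearB !linearZ /= IH1 !IH2 /GRing.scale /=; ring.
Qed.

Definition jac_norm gamma k : R := \prod_(i < k) gamma i.

(** A path shorter than [k] cannot descend from height [k], and the only one of length [k] falls all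
    the way; so only the coefficient of order [k] survives. *)
Lemma mom_lin_orth beta gamma (p : {poly R}) k : (size p <= k.+1)%N ->
  mom_lin (fun i => motzkin beta gamma i 0) (p * orth_poly beta gamma k) =
  p`_k * jac_norm gamma k.
Proof.
move=> pk; rewrite mom_linM; under eq_bigr do rewrite mom_lin_orth_poly.
have -> : \sum_(i < size p) p`_i * motzkin beta gamma i k =
    \sum_(i < k.+1) p`_i * motzkin beta gamma i k.
  rewrite (big_ord_widen k.+1 (fun i => p`_i * motzkin beta gamma i k)) //.
  rewrite big_mkcond; apply: eq_bigr => i _; case: ltnP => // ip.
  by rewrite nth_default ?mul0r.
rewrite big_ord_recr /= motzkin_diag big1 ?add0r // => i _.
by rewrite motzkin_gt ?mulr0.
Qed.

Lemma mom_lin_orth_neq beta gamma m k : m != k ->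
  mom_lin (fun i => motzkin beta gamma i 0)
    (orth_poly beta gamma m * orth_poly beta gamma k) = 0.
Proof.
wlog mk : m k / (m < k)%N => [wl|_].
  by rewrite neq_ltn => /orP[?|?]; [|rewrite mulrC]; apply: wl => //; lia.
have sm := (orth_poly_monic beta gamma m).2.
rewrite mom_lin_orth ?sm; last exact: leqW.
by rewrite nth_default ?mul0r // sm.
Qed.

Lemma mom_lin_orth_sqr beta gamma k :
  mom_lin (fun i => motzkin beta gamma i 0)
    (orth_poly beta gamma k * orth_poly beta gamma k) = jac_norm gamma k.
Proof.
have [mk sk] := orth_poly_monic beta gamma k.
rewrite mom_lin_orth ?sk // (_ : _`_k = 1) ?mul1r //.
by move/monicP: mk; rewrite /lead_coef sk.
Qed.

(** Orthogonality to P 0 = 1 makes every later P k have integral 0, and the recurrence then yields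
    all moments. With the converse below, being Jacobi parameters becomes a condition on moments and
    signs. *)
Lemma is_jacobi_moment (mu : probability R R) beta gamma :
  is_jacobi mu beta gamma -> moment mu =1 (fun n => motzkin beta gamma n 0).
Proof.
move=> [fm _ [P [P0 Pm Porth P1 PS]]] n.
rewrite -(motzkin_moments (s := moment mu) P0 P1 PS) ?P0 ?mulr1 ?mom_linXn //.
move=> [|k]; first by rewrite P0 mom_lin1 moment0.
rewrite -Rintegral_poly // -[RHS](Porth k.+1 0%N) //.
by apply: eq_Rintegral => x _; rewrite P0 hornerC mulr1.
Qed.

Lemma moment_is_jacobi (mu : probability R R) beta gamma :
  finite_moments mu -> (forall m, 0 <= gamma m) ->
  moment mu =1 (fun n => motzkin beta gamma n 0) -> is_jacobi mu beta gamma.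
Proof.
move=> fm g0 /funext mE; split=> //; exists (orth_poly beta gamma); split.
- exact: orth_poly0.
- exact: orth_poly_monic.
- move=> m k mk; rewrite -(mom_lin_orth_neq beta gamma mk) -mE -Rintegral_poly //.
  by apply: eq_Rintegral => x _; rewrite hornerM.
- by rewrite orth_poly0 orth_poly1 mulr1 -mul_polyC mulr1 subrK.
- exact: mulX_orth_poly.
Qed.

End OrthogonalPolynomials.

(** * Favard's theorem for bounded parameters *)

(** Factorial moments of the binomial law. The induction on [k] absorbs a factor [i] into the
    binomial coefficient. *)
Lemma ffact_bernstein (A : comPzRingType) (x y : A) k n : x + y = 1 ->
  \sum_(i < n.+1) (x ^+ i * y ^+ (n - i)) *+ (i ^_ k * 'C(n, i)) =
  x ^+ k *+ (n ^_ k).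
Proof.
move=> xy1; elim: k n => [|k IHk] n.
  under eq_bigr do rewrite ffactn0 mul1n [x ^+ _ * _]mulrC.
  rewrite ffactn0 expr0 mulr1n -[RHS](expr1n _ n) -xy1 [x + y]addrC exprDn.
  by apply: eq_bigr => i _.
case: n => [|n].
  by rewrite big_ord1 !ffact0n mul0n !mulr0n.
rewrite big_ord_recl ffact0n mul0n mulr0n add0r.
have -> : x ^+ k.+1 *+ n.+1 ^_ k.+1 = (x * (x ^+ k *+ n ^_ k)) *+ n.+1.
  by rewrite ffactnS mulnC mulrnA exprS mulrnAr.
rewrite -IHk mulr_sumr -sumrMnl; apply: eq_bigr => i _.
rewrite lift0 subSS exprS -mulrA [in RHS]mulrnAr -mulrnA; congr (_ *+ _).
have h := mul_bin_diag n.+1 i.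
by rewrite ffactnS mulnAC -h mulnC mulnCA mulnC.
Qed.

Lemma leq_ffact_exp i k : (i ^_ k <= i ^ k)%N.
Proof.
elim: k => // k IHk; rewrite ffactnSr expnSr leq_mul //; exact: leq_subr.
Qed.

(** Division-free form of (i/n)^k - i^_k / n^k <= k^2 / n. *)
Lemma leq_exp_ffact i n k : (i <= n)%N ->
  (n * i ^ k <= n * i ^_ k + k ^ 2 * n ^ k)%N.
Proof.
move=> ilen; elim: k => [|k IHk]; first by rewrite ffactn0 leq_addr.
rewrite expnS ffactnSr.
have [ik|ki] := ltnP i k.
  have i0 : i ^_ k = 0%N by apply: ffact_small.
  rewrite i0 in IHk *; rewrite !mul0n muln0 add0n in IHk *.
  rewrite mulnCA; apply: (leq_trans (leq_mul ilen IHk)).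
  by rewrite mulnCA -expnS leq_mul2r leq_exp2r // leqnSn orbT.
have h1 : (i * (n * i ^ k) <= n * (i * i ^_ k) + n * (k ^ 2 * n ^ k))%N.
  rewrite (leq_trans (leq_mul (leqnn i) IHk)) // mulnDr mulnCA leq_add2l.
  exact: leq_mul.
have h2 : (i * i ^_ k = i ^_ k * (i - k) + k * i ^_ k)%N by nia.
have h3 : (i ^_ k <= n ^ k)%N.
  rewrite (leq_trans (leq_ffact_exp _ _)) //.
  by case: (posnP k) => [->//|k0]; rewrite leq_exp2r.
have h4 : (n * (k * i ^_ k) <= n * (k * n ^ k))%N 
  by rewrite !leq_mul2l h3 !orbT.
rewrite h2 mulnDr in h1.
have -> : (n ^ k.+1 = n * n ^ k)%N by rewrite expnS.
rewrite mulnCA; apply: leq_trans h1 _; rewrite -addnA leq_add2l.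
apply: leq_trans (leq_add h4 (leqnn _)) _.
by rewrite !(mulnCA n) -mulnDl leq_mul2r; apply/orP; right; rewrite -!mulnn; nia.
Qed.

Lemma pushforward_moments (R : realType) (P : probability R R) (Q : R -> R) :
  measurable_fun setT Q ->
  (forall k, P.-integrable setT (fun u => (Q u ^+ k)%:E)) ->
  exists nu : probability R R, finite_moments nu /\
    forall k, moment nu k = \int[P]_u (Q u ^+ k).
Proof.
move=> mQ iQ.
pose X : {mfun R >-> R} := mfun_Sub (mem_set mQ).
have mpow k : measurable_fun [set: R] (EFin \o (fun x : R => x ^+ k)).
  by apply/measurable_EFinP; exact: exprn_measurable.
exists (distribution P X); split=> k.
  exact: (integrable_pushforward mQ (mpow k) (iQ k) measurableT).
by rewrite /moment /Rintegral (integral_pushforward mQ (mpow k) (iQ k) measurableT).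
Qed.

(** * Step functions of a uniform variable *)

Section StepFunctions.
Variables (R : realType) (P : probability R R).
Hypothesis P_uniform : forall D : R, 0 <= D <= 1 ->
  P [set u | D <= u]%classic = (1 - D)%:E.

Lemma count_step (f : nat -> R) (D : nat -> R) n u :
  (forall i j, (i <= j)%N -> D i <= D j) ->
  f (\sum_(i < n) (D i <= u)%R)%N =
  f 0%N + \sum_(i < n) (f i.+1 - f i) * (D i <= u)%R%:R.
Proof.
move=> Dmono; elim: n => [|n IHn]; first by rewrite !big_ord0 addr0.
rewrite !big_ord_recr /= addrA -IHn; case: (leP (D n) u) => Dn.
  have E m : (m <= n)%N -> (\sum_(i < m) (D i <= u)%R)%N = m.
    move=> mn; rewrite -[RHS]card_ord -sum1_card; apply: eq_bigr => i _.
    by rewrite (le_trans _ Dn) // Dmono // (leq_trans _ mn) // ltnW.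
  by rewrite E // addn1 mulr1 addrC subrK.
by rewrite addn0 mulr0 addr0.
Qed.

Lemma integral_step (f : nat -> R) (D : nat -> R) n :
  (forall i, (i < n)%N -> 0 <= D i <= 1) ->
  P.-integrable setT
    (fun u => (f 0%N + \sum_(i < n) (f i.+1 - f i) * (D i <= u)%R%:R)%:E) /\
  \int[P]_u (f 0%N + \sum_(i < n) (f i.+1 - f i) * (D i <= u)%R%:R) =
  f 0%N + \sum_(i < n) (f i.+1 - f i) * (1 - D i).
Proof.
elim: n => [|n IHn] D01.
  under eq_fun do rewrite big_ord0 addr0; under eq_Rintegral do rewrite big_ord0 addr0.
  split; first exact: finite_measure_integrable_cst.
  by rewrite big_ord0 addr0 Rintegral_cst//= probability_setT mulr1.
have [|I1 I2] := IHn; first by move=> i ni; apply: D01; exact: leqW.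
have mA : measurable [set u : R | D n <= u]%classic.
  by rewrite -set_itvcy; exact: measurable_itv.
have indE u : (D n <= u)%R%:R = \1_([set u : R | D n <= u]%classic) u :> R.
  by rewrite indicE; congr (_%:R); apply/esym; rewrite mem_setE.
have J : P.-integrable setT (fun u => ((D n <= u)%R%:R)%:E).
  under eq_fun do rewrite indE.
  by apply: integrable_indic => //; rewrite setTI.
have J' : P.-integrable setT (fun u => ((f n.+1 - f n) * (D n <= u)%R%:R)%:E).
  by have := integrableZl measurableT (f n.+1 - f n) J; under eq_fun do rewrite -EFinM.
split.
  under eq_fun do rewrite big_ord_recr /= addrA EFinD.
  exact: integrableD.
under eq_Rintegral do rewrite big_ord_recr /= addrA.
rewrite RintegralD // I2 big_ord_recr /= addrA; congr (_ + _).
rewrite RintegralZl //; congr (_ * _); rewrite /Rintegral.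
under eq_integral do rewrite indE.
transitivity (fine (1 - D n)%:E) => //; congr fine.
rewrite integral_indic // setIT; exact: (P_uniform (D01 n (ltnSn n))).
Qed.

Lemma sum_by_parts (f c D : nat -> R) n :
  (forall i, D i = \sum_(j < i.+1) c j) ->
  f 0%N + \sum_(i < n) (f i.+1 - f i) * (1 - D i) =
  \sum_(j < n.+1) c j * f j + (1 - D n) * f n.
Proof.
move=> DE; elim: n => [|n IHn].
  by rewrite big_ord0 big_ord1 DE big_ord1; ring.
rewrite big_ord_recr /= addrA IHn (DE n.+1) [\sum_(j < n.+2) c j]big_ord_recr /=.
rewrite -DE [\sum_(j < n.+2) _]big_ord_recr /=; ring.
Qed.

(** Inverse transform sampling: the number of cumulative weights at most a uniform [u] equals [j]
    with probability [c j]. *)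
Lemma integral_count (f c : nat -> R) n :
  (forall i, 0 <= c i) -> \sum_(j < n.+1) c j = 1 ->
  P.-integrable setT
    (fun u => (f (\sum_(i < n) (\sum_(j < i.+1) c j <= u)%R)%N)%:E) /\
  \int[P]_u f (\sum_(i < n) (\sum_(j < i.+1) c j <= u)%R)%N =
  \sum_(j < n.+1) c j * f j.
Proof.
move=> c0 c1; pose D i := \sum_(j < i.+1) c j.
have Dmono i j : (i <= j)%N -> D i <= D j.
  move=> ij; rewrite /D (big_ord_widen j.+1 c) //.
  rewrite [leRHS](bigID (fun k : 'I__ => (k < i.+1)%N)) /=.
  by rewrite lerDl sumr_ge0.
have D01 i : (i < n)%N -> 0 <= D i <= 1.
  move=> ni; rewrite sumr_ge0 //= -c1; apply: (Dmono i n); exact: ltnW.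
have [I1 I2] := integral_step f D01.
have E u : f (\sum_(i < n) (D i <= u)%R)%N =
    f 0%N + \sum_(i < n) (f i.+1 - f i) * (D i <= u)%R%:R.
  exact: count_step.
split; first by under eq_fun do rewrite -/(D _) E.
under eq_Rintegral do rewrite E.
by rewrite I2 (sum_by_parts f n (fun=> erefl)) /D c1 subrr mul0r addr0.
Qed.

(** Monotonicity squeezes [g] between two step functions whose integrals differ by the mesh. That
    the error does not depend on [g] is what later permits passing to the limit. *)
Lemma riemann_sum (g : R -> R) N : (forall u v, u <= v -> g u <= g v) ->
  (forall u, 0 <= g u <= 1) ->
  P.-integrable setT (fun u => (g u)%:E) /\
  `|\int[P]_u g u - \sum_(j < N.+1) N.+1%:R^-1 * g (j%:R / N.+1%:R)| <=
  N.+1%:R^-1.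
Proof.
move=> gmono g01.
have N0 : 0 < N.+1%:R :> R by rewrite ltr0n.
have ig : P.-integrable setT (fun u => (g u)%:E).
  apply: (@measurable_bounded_integrable _ _ _ P g setT) => //.
  - by apply: fin_num_fun_lty => //; exact: fin_num_measure.
  - by apply: nondecreasing_measurable.
  - exists 1; split=> // M M1 x _ /=.
    by have /andP[gx1 gx2] := g01 x; rewrite ger0_norm // (le_trans gx2) // ltW.
split=> //.
pose c (j : nat) : R := N.+1%:R^-1.
have c0 i : 0 <= c i by rewrite invr_ge0 ltW.
have cS m : \sum_(j < m) c j = m%:R / N.+1%:R.
  by rewrite /c sumr_const card_ord -[LHS]mulr_natl.
have c1 : \sum_(j < N.+1) c j = 1 by rewrite cS divff // gt_eqF.
(* The extreme cells also collect every [u] below 0 or above 1, where only 0 <= g <= 1 is available;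
   hence the values 0 and 1 there. *)
pose f1 (j : nat) := if j == 0%N then 0 else g (j%:R / N.+1%:R).
pose f2 (j : nat) := if j == N then 1 else g (j.+1%:R / N.+1%:R).
have [i1 I1] := integral_count f1 c0 c1; have [i2 I2] := integral_count f2 c0 c1.
pose cnt u := (\sum_(i < N) (\sum_(j < i.+1) c j <= u)%R)%N.
(* The number of thresholds passed locates [u] between two grid points; stated for the first [m]
   thresholds to allow induction. *)
have cntE u m : (m <= N)%N -> forall k, (k = \sum_(i < m) (\sum_(j < i.+1) c j <= u)%R)%N ->
    ((0 < k)%N -> k%:R / N.+1%:R <= u) /\ ((k < m)%N -> u <= k.+1%:R / N.+1%:R).
  elim: m => [|m IHm] mN k kE.
    by rewrite big_ord0 in kE; rewrite kE; split.
  rewrite big_ord_recr /= cS in kE.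
  have [||IH1 IH2] := IHm _ (\sum_(i < m) (\sum_(j < i.+1) c j <= u)%R)%N => //.
    exact: ltnW.
  set k' := (\sum_(i < m) (\sum_(j < i.+1) c j <= u)%R)%N in kE IH1 IH2.
  have k'm : (k' <= m)%N.
    rewrite -[leqRHS]card_ord -sum1_card; apply: leq_sum => i _; exact: leq_b1.
  move: kE; case: leP => mu kE.
    have k'E : k' = m.
      apply/eqP; rewrite eqn_leq k'm leqNgt; apply/negP => k'lt.
      have := le_trans mu (IH2 k'lt); rewrite ler_pM2r ?invr_gt0 // ler_nat.
      by rewrite ltnS leqNgt k'lt.
    by rewrite kE k'E addn1 ltnn; split.
  rewrite addn0 in kE; rewrite kE; split=> // k'lt.
  by case: (ltnP k' m) => [/IH2//|mk']; rewrite (_ : k' = m) ?ltW //; lia.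
have cntP u : f1 (cnt u) <= g u <= f2 (cnt u).
  have [h1 h2] := cntE u N (leqnn N) (cnt u) erefl.
  have cN : (cnt u <= N)%N.
    rewrite -[leqRHS]card_ord -sum1_card; apply: leq_sum => i _; exact: leq_b1.
  have /andP[gu0 gu1] := g01 u; rewrite /f1 /f2; apply/andP; split.
    by case: eqP => // /eqP; rewrite -lt0n => /h1; exact: gmono.
  case: eqP => // /eqP cN'; apply: gmono; apply: h2.
  by rewrite ltn_neqAle cN' cN.
pose S := \sum_(j < N) c j * g (j.+1%:R / N.+1%:R).
have L1 : S <= \int[P]_u g u.
  have -> : S = \int[P]_u f1 (cnt u).
    by rewrite I1 big_ord_recl /f1 eqxx mulr0 add0r.
  by apply: le_Rintegral => // u _; case/andP: (cntP u).
have L2 : \int[P]_u g u <= S + N.+1%:R^-1.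
  have -> : S + N.+1%:R^-1 = \int[P]_u f2 (cnt u).
    rewrite I2 big_ord_recr /= /f2 eqxx mulr1; congr (_ + _).
    by apply: eq_bigr => i _; rewrite (ltn_eqF (ltn_ord i)).
  by apply: le_Rintegral => // u _; case/andP: (cntP u).
have L3 : \sum_(j < N.+1) N.+1%:R^-1 * g (j%:R / N.+1%:R) = N.+1%:R^-1 * g 0 + S.
  by rewrite big_ord_recl mul0r.
have L4 : 0 <= N.+1%:R^-1 * g 0 <= N.+1%:R^-1.
  have /andP[? ?] := g01 0.
  have ? : 0 <= N.+1%:R^-1 :> R by rewrite invr_ge0 ltW.
  by apply/andP; split; [exact: mulr_ge0|exact: ler_piMr].
rewrite L3 {L3}; move: (\int[P]_u g u) (N.+1%:R^-1 * g 0) N.+1%:R^-1 S L1 L2 L4.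
by move=> x y z S ? ? /andP[? ?]; rewrite ler_norml; apply/andP; split; lra.
Qed.

End StepFunctions.

Lemma uniform_probability (R : realType) : exists P : probability R R,
  forall D : R, 0 <= D <= 1 -> P [set u | D <= u]%classic = (1 - D)%:E.
Proof.
(* The identity only carries the uniform law from [measurableTypeR R] over to [R]. *)
pose idTR : measurableTypeR R -> R := idfun.
have midTR : measurable_fun setT idTR by exact: measurable_id.
pose X := mfun_Sub (mem_set midTR).
exists (distribution (uniform_prob (@ltr01 R)) X) => D /andP[D0 D1].
rewrite /distribution /pushforward /= /uniform_prob integral_uniform_pdf.
have -> : (X @^-1` [set u : R | D <= u] `&` `[0, 1])%classic = `[D, 1]%classic.
  apply/seteqP; split=> u /=; rewrite !in_itv /=.
    by move=> [Du /andP[_ u1]]; rewrite Du u1.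
  move=> /andP[Du u1].
  by rewrite Du u1 (le_trans D0).
rewrite (eq_integral (fun=> 1%:E)); last first.
  move=> x; rewrite inE /= in_itv /= => /andP[Dx x1].
  by rewrite /uniform_pdf x1 (le_trans D0) //= subr0 invr1.
rewrite integral_cst //= mul1e lebesgue_measure_itv /= lte_fin.
by case: ltgtP D1 => // -> _; rewrite subrr.
Qed.

(** * The Hausdorff moment problem *)

Section HausdorffMoments.
Variables (R : realType) (h : nat -> R).
Hypothesis h0 : h 0%N = 1.
Hypothesis h_ge0 : forall i j, 0 <= mom_lin h ('X^i * (1 - 'X) ^+ j).

(** The mass at i / n of the sought law after binomial smoothing. *)
Definition bernstein_weight n i : R :=
  mom_lin h ('X^i * (1 - 'X) ^+ (n - i)) *+ 'C(n, i).

Lemma bernstein_weight_ge0 n i : 0 <= bernstein_weight n i.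
Proof. exact: mulrn_wge0. Qed.

Lemma sum_bernstein_ffact n k :
  \sum_(i < n.+1) bernstein_weight n i * (i ^_ k)%:R = h k * (n ^_ k)%:R.
Proof.
have xy : 'X + (1 - 'X) = 1 :> {poly R} by rewrite addrC subrK.
have := congr1 (mom_lin h) (ffact_bernstein k n xy).
rewrite raddfMn /= mom_linXn mulr_natr => <-; rewrite linear_sum /=.
by apply: eq_bigr => i _; rewrite raddfMn /= mulr_natr -mulrnA mulnC.
Qed.

Lemma sum_bernstein n : \sum_(i < n.+1) bernstein_weight n i = 1.
Proof.
have := sum_bernstein_ffact n 0; rewrite ffactn0 mulr1 h0 => <-.
by apply: eq_bigr => i _; rewrite ffactn0 mulr1.
Qed.

Lemma ffact_ratio_bound i N k : (0 < N)%N -> (i <= N)%N ->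
  0 <= (i%:R / N%:R : R) ^+ k - (i ^_ k)%:R / N%:R ^+ k <= (k ^ 2)%:R / N%:R.
Proof.
move=> N0 iN; have N0' : 0 < N%:R :> R by rewrite ltr0n.
have Nk0 : 0 < N%:R ^+ k :> R by rewrite exprn_gt0.
rewrite expr_div_n -mulrBl -natrX; apply/andP; split.
  apply: divr_ge0; last exact: ltW.
  by rewrite subr_ge0 ler_nat leq_ffact_exp.
rewrite ler_pdivrMr // mulrAC ler_pdivlMr // mulrC mulrBr lerBlDl.
by rewrite -[N%:R ^+ k]natrX -!natrM -natrD ler_nat leq_exp_ffact.
Qed.

Lemma bernstein_moment n k :
  `|\sum_(i < n.+2) bernstein_weight n.+1 i * (i%:R / n.+1%:R) ^+ k - h k| <=
  (1 + `|h k|) * (k ^ 2)%:R * n.+1%:R^-1.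
Proof.
set N := n.+1; have Nk0 : 0 < N%:R ^+ k :> R by rewrite exprn_gt0.
(* The normalised factorial moment is known exactly. Replacing powers by falling factorials costs
   k^2 / N, and its distance to [h k] costs [|h k|] times as much. *)
pose B := \sum_(i < N.+1) bernstein_weight N i * ((i ^_ k)%:R / N%:R ^+ k).
have BE : B = h k * ((N ^_ k)%:R / N%:R ^+ k).
  by rewrite mulrA -sum_bernstein_ffact mulr_suml; apply: eq_bigr => i _; rewrite mulrA.
rewrite -(subrKA B) (le_trans (ler_normD _ _)) // mulrDl mulrDl mul1r lerD //.
  rewrite -sumrB ger0_norm; last first.
    apply: sumr_ge0 => i _; rewrite -mulrBr mulr_ge0 ?bernstein_weight_ge0 //.
    by case/andP: (@ffact_ratio_bound i N k (ltn0Sn n) (leq_ord i)).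
  have -> : (k ^ 2)%:R / N%:R =
      \sum_(i < N.+1) bernstein_weight N i * ((k ^ 2)%:R / N%:R).
    by rewrite -mulr_suml sum_bernstein mul1r.
  apply: ler_sum => i _.
  rewrite -mulrBr ler_wpM2l ?bernstein_weight_ge0 //.
  by case/andP: (@ffact_ratio_bound i N k (ltn0Sn n) (leq_ord i)).
rewrite BE -[X in _ - X]mulr1 -mulrBr normrM -mulrA ler_wpM2l //.
have := @ffact_ratio_bound N N k (ltn0Sn n) (leqnn N).
by rewrite divff ?pnatr_eq0 // expr1n distrC => /andP[? ?]; rewrite ger0_norm.
Qed.

Definition bernstein_quantile n (u : R) : R :=
  (\sum_(i < n.+1) (\sum_(j < i.+1) bernstein_weight n.+1 j <= u)%R)%N%:R / n.+1%:R.

Lemma bernstein_quantile_mono n u v : u <= v ->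
  bernstein_quantile n u <= bernstein_quantile n v.
Proof.
move=> uv; rewrite ler_wpM2r ?invr_ge0 ?ler0n // ler_nat; apply: leq_sum => i _.
by case: (leP _ u) => // /le_trans/(_ uv) ->.
Qed.

Lemma bernstein_quantile01 n u : 0 <= bernstein_quantile n u <= 1.
Proof.
rewrite divr_ge0 ?ler0n //= ler_pdivrMr ?ltr0n // mul1r ler_nat.
by rewrite -[leqRHS]card_ord -sum1_card; apply: leq_sum => i _; exact: leq_b1.
Qed.

(** One ultrafilter serves all bounded sequences at once, so no subsequence has to be extracted for
    uncountably many arguments [u]; containing [\oo], it preserves ordinary limits. *)
Lemma ultra_limits : exists2 G : set_system nat, UltraFilter G /\ (\oo `<=` G)%classic &
  forall a : nat -> R, (forall n, 0 <= a n <= 1) ->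
    exists l : R, (a @ G --> l)%classic.
Proof.
have [G [GU sG]] := ultraFilterLemma (@eventually_filter).
exists G => // a a01.
have [|l [_ cl]] := @segment_compact R 0 1 (a @ G)%classic _.
  by apply: (@filterE _ G) => n; rewrite /= in_itv /=.
exists l => A nA.
have [//|GA] := in_ultra_setVsetC (a @^-1` A)%classic GU.
by have [x [nAx Ax]] := cl (~` A)%classic A GA nA.
Qed.

(* The quantile functions of the Bernstein discretisations converge along an
   ultrafilter to the quantile function of the sought measure; monotonicity makes
   Riemann sums approximate all the integrals uniformly. *)
Theorem hausdorff_moments : exists nu : probability R R,
  finite_moments nu /\ moment nu =1 h.
Proof.
have [P PU] := uniform_probability R.
have [G [GU sG] Glim] := ultra_limits.
have /boolp.choice[Q QE] : forall u, exists l : R,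
    ((fun n => bernstein_quantile n u) @ G --> l)%classic.
  by move=> u; apply: Glim => n; exact: bernstein_quantile01.
have Q01 u : 0 <= Q u <= 1.
  apply/andP; split.
    apply: (ler_cvg_to (cvg_cst (0 : R)) (QE u)); apply: nearW => n.
    by case/andP: (bernstein_quantile01 n u).
  apply: (ler_cvg_to (QE u) (cvg_cst (1 : R))); apply: nearW => n.
  by case/andP: (bernstein_quantile01 n u).
have Qmono u v : u <= v -> Q u <= Q v.
  move=> uv; apply: (ler_cvg_to (QE u) (QE v)); apply: nearW => n.
  exact: bernstein_quantile_mono.
have pow01 (x : R) k : 0 <= x <= 1 -> 0 <= x ^+ k <= 1.
  by move=> /andP[x0 x1]; rewrite exprn_ge0 //= exprn_ile1.
have powmono k (g : R -> R) : (forall u, 0 <= g u <= 1) ->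
    (forall u v, u <= v -> g u <= g v) -> forall u v, u <= v -> g u ^+ k <= g v ^+ k.
  move=> g01 gm u v uv; apply: lerXn2r; rewrite ?nnegrE ?gm //.
  - by case/andP: (g01 u).
  - by case/andP: (g01 v).
pose RS N M (g : R -> R) := \sum_(j < M) N.+1%:R^-1 * g (j%:R / N.+1%:R).
have RQ k N := riemann_sum PU N (powmono k Q Q01 Qmono) (fun u => pow01 _ k (Q01 u)).
have mQ : measurable_fun setT Q by exact: nondecreasing_measurable.
have [nu [fnu nuE]] := pushforward_moments mQ (fun k => (RQ k 0%N).1).
exists nu; split=> // k; rewrite nuE.
pose Qn n u := bernstein_quantile n u ^+ k.
have RQn n N := riemann_sum PU N
  (powmono k _ (bernstein_quantile01 n) (@bernstein_quantile_mono n))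
  (fun u => pow01 _ k (bernstein_quantile01 n u)).
have IQn n : \int[P]_u Qn n u =
    \sum_(i < n.+2) bernstein_weight n.+1 i * (i%:R / n.+1%:R) ^+ k.
  exact: (integral_count PU (fun j => (j%:R / n.+1%:R) ^+ k)
    (bernstein_weight_ge0 n.+1) (sum_bernstein n.+1)).2.
have cvgI : ((fun n => \int[P]_u Qn n u) @ G --> h k)%classic.
  suff : ((fun n => \int[P]_u Qn n u) @ \oo --> h k)%classic.
    by apply: cvg_trans => A /sG.
  apply/cvgrPdist_le => e e0.
  have C0 : ((fun n => (1 + `|h k|) * (k ^ 2)%:R * n.+1%:R^-1 : R) @ \oo --> (0 : R))%classic.
    rewrite -[X in (_ --> X)%classic](mulr0 ((1 + `|h k|) * (k ^ 2)%:R)).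
    apply: cvgMr; exact: cvg_harmonic.
  near=> n; rewrite distrC IQn (le_trans (bernstein_moment n k)) //.
  rewrite (le_trans (ler_norm _)) //; near: n; exact: cvgr0_norm_le.
have cvgRS N M : ((fun n => RS N M (Qn n)) @ G --> RS N M (fun u => Q u ^+ k))%classic.
  rewrite /RS; elim: M => [|M IHM].
    by rewrite big_ord0; under eq_fun do rewrite big_ord0; exact: cvg_cst.
  rewrite big_ord_recr /=; under eq_fun do rewrite big_ord_recr /=.
  have cQ : ((fun n => Qn n (M%:R / N.+1%:R)) @ G -->
      Q (M%:R / N.+1%:R) ^+ k)%classic.
    exact: (cvg_comp _ _ (QE _) (@exprn_continuous R k _)).
  by apply: cvgD; [exact: IHM|apply: cvgMr; exact: cQ].
(* A Riemann sum is finite, so it passes to the limit along [G]. One mesh is paid for the limit [Q]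
   and one, uniformly in [n], for its approximants. *)
have key N : `|\int[P]_u (Q u ^+ k) - h k| <= N.+1%:R^-1 *+ 2.
  have H1 := (RQ k N).2.
  have H2 : `|RS N N.+1 (fun u => Q u ^+ k) - h k| <= N.+1%:R^-1.
    apply: (ler_cvg_to (cvg_norm (cvgB (cvgRS N N.+1) cvgI)) (cvg_cst _)).
    by apply: nearW => n /=; rewrite distrC; exact: (RQn n N).2.
  rewrite -(subrKA (RS N N.+1 (fun u => Q u ^+ k))) (le_trans (ler_normD _ _)) //.
  by rewrite mulr2n lerD.
apply/eqP; rewrite -subr_eq0 -normr_le0; apply/ler_addgt0Pl => e e0.
rewrite addr0; have [N] : exists N : nat, N.+1%:R^-1 < e / 2.
  have := @near_infty_natSinv_lt R (PosNum (divr_gt0 e0 (ltr0n R 2))).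
  by move=> -[N _ /(_ N (leqnn N))]; exists N.
by move=> Ne; rewrite (le_trans (key N)) // mulr2n [leRHS]splitr lerD // ltW.
Unshelve. all: by end_near. Qed.

End HausdorffMoments.

(** * Positivity of bounded Jacobi forms and reduction to the Hausdorff problem *)

Section Favard.
Variables (R : realType) (beta gamma : nat -> R) (B K : R).
Hypothesis K_gt0 : 0 < K.
Hypothesis beta_bound : forall i, `|beta i| <= B.
Hypothesis gamma_bound : forall i, 0 <= gamma i <= K ^+ 2.

Local Notation L := (mom_lin (fun i => motzkin beta gamma i 0)).
Local Notation P := (orth_poly beta gamma).
Local Notation g := (jac_norm gamma).
(** Norm bound of the symmetric Jacobi matrix with diagonal [beta] and off-diagonal entries the
    square roots of [gamma]: it makes both M + x and M - x positive for the form. *)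
Let M : R := B + K *+ 2.

Lemma jac_norm_ge0 k : 0 <= g k.
Proof. by apply: prodr_ge0 => i _; case/andP: (gamma_bound i). Qed.

Lemma jac_normS k : g k.+1 = g k * gamma k.
Proof. by rewrite /jac_norm big_ord_recr. Qed.

Lemma beta_bound_ge0 : 0 <= B.
Proof. exact: le_trans (normr_ge0 (beta 0%N)) _. Qed.

Lemma form_bound_gt0 : 0 < M.
Proof. by rewrite /M ltr_wpDl ?beta_bound_ge0 // mulrn_wgt0. Qed.

Lemma mom_linC (c : R) : L c%:P = c.
Proof. by rewrite -alg_polyC linearZ /= mom_lin1 mulr1. Qed.

(* The extra term on the left carries the cross term of the next step. *)
Lemma jacobi_form_bound (e : R) n (q : {poly R}) : e ^+ 2 = 1 -> (size q <= n.+1)%N ->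
  K * q`_n ^+ 2 * g n <= L ((M%:P + e *: 'X) * (q * q)).
Proof.
move=> e2.
have eb i : K *+ 2 <= M + e * beta i.
  have : `|e * beta i| <= B.
    have -> : `|e * beta i| = `|beta i|.
      rewrite normrM (_ : `|e| = 1) ?mul1r //.
      by apply/eqP; rewrite -sqrp_eq1 // -normrX e2 normr1.
    exact: beta_bound.
  by rewrite ler_norml /M => /andP[? _]; lra.
elim: n q => [|n IHn] q sq.
  have [a ->] : exists a, q = a%:P by exists q`_0; exact: size1_polyC.
  rewrite coefC /= -polyCM [_ * (a * a)%:P]mulrC mul_polyC linearZ linearD linearZ /= mom_linC.
  rewrite -['X]expr1 mom_linXn /= /jac_norm big_ord0 mulr1 add0r mulr1 addr0.
  have := eb 0%N; have := sqr_ge0 a; rewrite -expr2 => a0 b0.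
  rewrite mulrC ler_wpM2l //; apply: le_trans b0.
  by rewrite mulr2n lerDl ltW.
(* Split off the top orthogonal component; multiplication by ['X] couples it only to the component
   of order [n] in [q']. *)
set a := q`_n.+1; pose q' := q - a *: P n.+1.
have [Pm Ps] := orth_poly_monic beta gamma n.+1.
have P1 : (P n.+1)`_n.+1 = 1 by move/monicP: Pm; rewrite /lead_coef Ps.
have q'n : q'`_n.+1 = 0 by rewrite coefB coefZ P1 mulr1 subrr.
have sq' : (size q' <= n.+1)%N.
  apply/leq_sizeP => j; rewrite leq_eqVlt => /orP[/eqP<-//|nj].
  rewrite coefB coefZ !nth_default ?mulr0 ?subr0 //; first by rewrite Ps.
  exact: leq_trans sq _.
have qE : q = q' + a *: P n.+1 by rewrite subrK.
set W := M%:P + e *: 'X in IHn *.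
have -> : W * (q * q) = W * (q' * q') + (a *+ 2) *: (W * q' * P n.+1) +
    (a ^+ 2) *: (W * (P n.+1 * P n.+1)).
  rewrite qE -!mul_polyC polyCM polyCMn; ring.
have LW1 : L (W * q' * P n.+1) = e * q'`_n * g n.+1.
  rewrite mom_lin_orth; last first.
    rewrite (leq_trans (size_polyMleq _ _)) //.
    have : (size W <= 2)%N.
      rewrite (leq_trans (size_polyD _ _)) // geq_max.
      rewrite (leq_trans (size_polyC_leq1 _)) //=.
      by rewrite (leq_trans (size_scale_leq _ _)) // size_polyX.
    by move=> ?; lia.
  by rewrite mulrDl coefD coefCM q'n mulr0 add0r -scalerAl coefZ coefXM.
have LW2 : L (W * (P n.+1 * P n.+1)) = (M + e * beta n.+1) * g n.+1.
  have ne1 : n.+2 != n.+1 by lia.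
  have ne2 : n != n.+1 by lia.
  have XPP : L ('X * P n.+1 * P n.+1) = beta n.+1 * g n.+1.
    rewrite mulX_orth_poly 2!mulrDl 2!linearD -!scalerAl.
    rewrite !linearZ /= (mom_lin_orth_neq _ _ ne1).
    by rewrite (mom_lin_orth_neq _ _ ne2) mom_lin_orth_sqr mulr0 addr0 add0r.
  rewrite mulrDl mul_polyC -scalerAl mulrA linearD !linearZ /= mom_lin_orth_sqr.
  by rewrite XPP [RHS]mulrDl mulrA.
rewrite !linearD !linearZ /= LW1 LW2.
have := IHn _ sq'; rewrite jac_normS.
have g0 := jac_norm_ge0 n; have /andP[c0 c1] := gamma_bound n.
have := eb n.+1; set x := q'`_n; set c := gamma n in c0 c1 *; set G := g n in g0 *.
set Y := L _; set b := M + e * beta n.+1 => b0 IH.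
(* The term kept from the induction hypothesis and one K from the new diagonal entry absorb the
   cross term by completing the square, since c <= K^2. The other K is the term kept for the next
   step. *)
have h1 : 0 <= G * (K * x ^+ 2 + a *+ 2 * e * x * c + K * a ^+ 2 * c).
  apply: mulr_ge0 => //; rewrite -(pmulr_rge0 _ K_gt0).
  have -> : K * (K * x ^+ 2 + a *+ 2 * e * x * c + K * a ^+ 2 * c) =
    (K * x + a * e * c) ^+ 2 + a ^+ 2 * c * (K ^+ 2 - c * e ^+ 2) by ring.
  by rewrite e2 mulr1 addr_ge0 ?sqr_ge0 // mulr_ge0 ?subr_ge0 // mulr_ge0 ?sqr_ge0.
have h2 : 0 <= (b - K *+ 2) * (a ^+ 2 * (G * c)).
  by rewrite mulr_ge0 ?subr_ge0 // mulr_ge0 ?sqr_ge0 // mulr_ge0.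
rewrite -subr_ge0 in IH; rewrite -subr_ge0.
have -> : Y + a *+ 2 * (e * x * (G * c)) + a ^+ 2 * (b * (G * c)) - K * a ^+ 2 * (G * c) =
  (Y - K * x ^+ 2 * G) + G * (K * x ^+ 2 + a *+ 2 * e * x * c + K * a ^+ 2 * c) +
  (b - K *+ 2) * (a ^+ 2 * (G * c)) by ring.
by apply: addr_ge0 => //; exact: addr_ge0.
Qed.

Lemma jacobi_form_ge0 (e : R) (q : {poly R}) : e ^+ 2 = 1 ->
  0 <= L ((M%:P + e *: 'X) * (q * q)).
Proof.
move=> e2; apply: le_trans (jacobi_form_bound e2 (leqnSn (size q))).
by rewrite mulr_ge0 ?jac_norm_ge0 // mulr_ge0 ?sqr_ge0 // ltW.
Qed.

(** Affine change of variable taking [-M, M] to [0, 1]. *)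
Let y : {poly R} := (M *+ 2)^-1 *: ('X + M%:P).

Lemma unit_interval_form_ge0 (q : {poly R}) :
  [/\ 0 <= L (q * q), 0 <= L (y * (q * q)) & 0 <= L ((1 - y) * (q * q))].
Proof.
have M0 := form_bound_gt0; have M2 : 0 < M *+ 2 by rewrite mulrn_wgt0.
have hp := @jacobi_form_ge0 1 q (expr1n _ _).
have hm : 0 <= L ((M%:P + (- 1) *: 'X) * (q * q)).
  by apply: jacobi_form_ge0; rewrite sqrrN expr1n.
have yE : y * (q * q) = (M *+ 2)^-1 *: ((M%:P + 1 *: 'X) * (q * q)).
  by rewrite /y scale1r addrC scalerAl.
have zE : (1 - y) * (q * q) = (M *+ 2)^-1 *: ((M%:P + (- 1) *: 'X) * (q * q)).
  rewrite scalerAl; congr (_ * _); rewrite /y scaleN1r.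
  apply: (scalerI (lt0r_neq0 M2)); rewrite scalerBr !scalerA divff ?gt_eqF // !scale1r.
  by rewrite -mul_polyC polyCMn; ring.
have h1 : 0 <= L (y * (q * q)) by rewrite yE linearZ /= mulr_ge0 // invr_ge0 ltW.
have h2 : 0 <= L ((1 - y) * (q * q)) by rewrite zE linearZ /= mulr_ge0 // invr_ge0 ltW.
split=> //; have -> : q * q = y * (q * q) + (1 - y) * (q * q) by ring.
by rewrite linearD addr_ge0.
Qed.

(** Even powers form a square, so only the parities matter. When both are odd, use y (1 - y) = (1 -
    y) y^2 + y (1 - y)^2. *)
Lemma bernstein_form_ge0 i j : 0 <= L (y ^+ i * (1 - y) ^+ j).
Proof.
have -> : y ^+ i * (1 - y) ^+ j = y ^+ odd i * (1 - y) ^+ odd j *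
    ((y ^+ i./2 * (1 - y) ^+ j./2) * (y ^+ i./2 * (1 - y) ^+ j./2)).
  rewrite -{1}(odd_double_half i) -{1}(odd_double_half j) !exprD -!addnn !exprD; ring.
set q := y ^+ i./2 * _.
have [h1 h2 h3] := unit_interval_form_ge0 q.
case: (odd i); case: (odd j); rewrite ?expr1 ?expr0 ?mul1r ?mulr1 //.
have -> : y * (1 - y) * (q * q) =
    (1 - y) * ((y * q) * (y * q)) + y * (((1 - y) * q) * ((1 - y) * q)) by ring.
rewrite linearD addr_ge0 //.
  by have [] := unit_interval_form_ge0 (y * q).
by have [] := unit_interval_form_ge0 ((1 - y) * q).
Qed.

Theorem favard_bounded : exists nu : probability R R, is_jacobi nu beta gamma.
Proof.
pose h k := L (y ^+ k).
have hE p : mom_lin h p = L (p \Po y).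
  rewrite comp_polyE linear_sum; apply: eq_bigr => i _.
  by rewrite linearZ.
have [||nu0 [fm0 m0]] := @hausdorff_moments R h.
- by rewrite /h expr0 mom_lin1.
- move=> i j; rewrite hE rmorphM !rmorphXn rmorphB rmorph1 /= comp_polyX.
  exact: bernstein_form_ge0.
have m0E : moment nu0 = h by exact/funext.
(* Inverse of the change of variable [y]; pushing [nu0] forward along it restores the original
   moments. *)
pose q0 : {poly R} := (M *+ 2) *: 'X - M%:P.
have M2 : M *+ 2 != 0 by rewrite gt_eqF // mulrn_wgt0 // form_bound_gt0.
have q0y : q0 \Po y = 'X.
  rewrite /q0 rmorphB /= comp_polyC -mul_polyC rmorphM /= comp_polyC comp_polyX mul_polyC.
  by rewrite /y scalerA divff // scale1r addrK.
have iq k : nu0.-integrable setT (fun x => (q0.[x] ^+ k)%:E).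
  have [+ _] := integrable_poly fm0 (q0 ^+ k).
  by under eq_fun do rewrite horner_exp.
have mq : measurable_fun setT (fun x : R => q0.[x]).
  have [/integrableP[+ _] _] := integrable_poly fm0 q0.
  by move/measurable_EFinP.
have [nu [fm mE]] := pushforward_moments mq iq.
exists nu; apply: moment_is_jacobi => //.
  by move=> m; case/andP: (gamma_bound m).
move=> k; rewrite mE; under eq_Rintegral do rewrite -horner_exp.
by rewrite Rintegral_poly // m0E hE rmorphXn /= q0y mom_linXn.
Qed.

End Favard.

(** * Cumulants and moments of free powers *)

Section Cumulants.
Variable R : realType.
Implicit Types mu nu : probability R R.

Lemma eq_nc_sum (r r' : nat -> R) n : r =1 r' -> nc_sum r n = nc_sum r' n.
Proof. by move=> /funext ->. Qed.

Lemma free_cumulantE mu (r : nat -> R) : r 0%N = 0 ->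
  (forall n, moment mu n = nc_sum r n) -> free_cumulant mu =1 r.
Proof.
move=> r0 mE k; have H : is_free_cumulants (moment mu) r by [].
exact: is_free_cumulants_unique (free_cumulantP mu) H k.
Qed.

Lemma moment_free_power mu nu (t : R) : is_free_power mu t nu ->
  forall n, moment nu n = nc_sum (fun k => t * free_cumulant mu k) n.
Proof.
move=> [_ fE] n; rewrite (free_cumulantP nu).2; apply: eq_nc_sum => -[|k].
  by rewrite !(free_cumulantP _).1 mulr0.
exact: fE.
Qed.

Lemma head_tail_jacobi_exists (b0 b1 g0 g1 : R) : 0 <= g0 -> 0 <= g1 ->
  exists nu : probability R R, is_jacobi nu (head_tail b0 b1) (head_tail g0 g1).
Proof.
move=> g00 g10.
(* The summand 1 makes K positive and at least 1, so that K^2 >= K dominates both gammas. *)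
apply: (@favard_bounded R _ _ (`|b0| + `|b1|) (1 + g0 + g1)).
- lra.
- by move=> i; rewrite /head_tail; case: ifP => _; rewrite ?lerDl ?lerDr.
- by move=> i; rewrite /head_tail; case: ifP => _; apply/andP; split=> //; nra.
Qed.

Lemma meixner_free_cumulant mu (b0 b1 g0 g1 : R) :
  moment mu =1 (fun n => motzkin (head_tail b0 b1) (head_tail g0 g1) n 0) ->
  free_cumulant mu =1 meixner_cumulant b0 g0 (b1 - b0) (g1 - g0).
Proof.
move=> mE; apply: free_cumulantE => // n; rewrite mE.
have := nc_sum_meixner b0 g0 (b1 - b0) (g1 - g0) 1 n.
by rewrite !mulr1 !subrK => <-; apply: eq_nc_sum => k; rewrite mul1r.
Qed.

End Cumulants.

(** * Compact support and the resolvent integral *)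

Section Support.
Variables (R : realType) (rho : probability R R) (A : R).
Hypothesis A_gt0 : 0 < A.
Hypothesis fm : finite_moments rho.
Hypothesis moment_bound : forall n, `|moment rho n| <= A ^+ n.

Let D : set R := `](- (A *+ 2)), (A *+ 2)[%classic.

Lemma measurable_invr : measurable_fun [set: R] (fun x : R => x^-1).
Proof.
have -> : [set: R]%classic = ((`]-oo, 0[ `|` `]0, +oo[) `|` [set (0 : R)])%classic.
  apply/esym/seteqP; split=> // x _ /=; rewrite !in_itv /= andbT.
  by case: (ltgtP x 0); [left; left|left; right|right].
apply/measurable_funU; [by apply: measurableU|exact: measurable_set1|split].
  apply/measurable_funU => //; split.
    apply: open_continuous_measurable_fun; first exact: interval_open.
    move=> x; rewrite inE /= in_itv /= => x0.
    by apply: inv_continuous; rewrite lt_eqF.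
  apply: open_continuous_measurable_fun; first exact: interval_open.
  move=> x; rewrite inE /= in_itv /= andbT => x0.
  by apply: inv_continuous; rewrite gt_eqF.
exact: measurable_fun_set1.
Qed.

(** Markov's inequality with the power 2n: doubling the radius [A] gives the bound 4^-n for every
    n. *)
Lemma support_bound : rho (~` D)%classic = 0%E.
Proof.
have mD : measurable D by exact: measurable_itv.
have mDc : measurable (~` D)%classic by exact: measurableC.
have A2 : 0 < A *+ 2 by rewrite mulrn_wgt0.
have key n : fine (rho (~` D)%classic) <= (2^-1 ^+ 2) ^+ n.
  have -> : fine (rho (~` D)%classic) = \int[rho]_x (\1_(~` D)%classic x).
    by rewrite /Rintegral integral_indic // setIT.
  pose p : {poly R} := ((A *+ 2) ^+ n.*2)^-1 *: 'X^(n.*2).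
  have pE x : p.[x] = (x / (A *+ 2)) ^+ n.*2.
    by rewrite hornerZ hornerXn expr_div_n mulrC.
  have [ip Ip] := integrable_poly fm p.
  apply: (@le_trans _ _ (\int[rho]_x p.[x])).
    apply: le_Rintegral => //.
      by apply: integrable_indic => //; rewrite setTI.
    move=> x _; rewrite indicE pE; case: (boolP (x \in _)) => [|_]; last first.
      by rewrite -mul2n exprM exprn_ge0 // sqr_ge0.
    rewrite inE /D /= in_itv /= => /negP; rewrite -ltr_norml -leNgt => xA.
    rewrite -mul2n exprM; apply: exprn_ege1; rewrite -real_normK ?num_real //.
    apply: exprn_ege1; rewrite normrM normfV (gtr0_norm A2).
    by rewrite ler_pdivlMr // mul1r.
  rewrite Ip linearZ /= mom_linXn; have := moment_bound n.*2.
  rewrite ler_norml => /andP[_ mA].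
  rewrite (le_trans (ler_wpM2l _ mA)) //; first by rewrite invr_ge0 exprn_ge0 // ltW.
  rewrite mulrC -expr_div_n -mul2n exprM.
  have -> // : A / (A *+ 2) = 2^-1.
  by rewrite -mulr_natr; field; rewrite gt_eqF.
have f0 : 0 <= fine (rho (~` D)%classic) by exact: fine_ge0.
have fn : rho (~` D)%classic \is a fin_num by exact: fin_num_measure.
rewrite -(fineK fn); congr (_%:E); apply/eqP; rewrite eq_le f0 andbT.
have C : ((fun n => (2^-1 ^+ 2) ^+ n : R) @ \oo --> (0 : R))%classic.
  apply: (@cvg_expr R (2^-1 ^+ 2)); rewrite ger0_norm ?sqr_ge0 //; lra.
by apply: (ler_cvg_to (cvg_cst _) C); apply: nearW => n; exact: key.
Qed.

(** The radius is chosen so that |z x| <= 1/2 on [D], which carries [rho]: the integrand is then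
    bounded by 2 and the geometric series converges uniformly there. *)
Lemma resolvent_series (z : R) : `|z| < (A *+ 4)^-1 ->
  rho.-integrable setT (fun x : R => ((1 - z * x)^-1)%:E) /\
  (series (fun k => moment rho k * z ^+ k) @ \oo -->
   \int[rho]_x (1 - z * x)^-1)%classic.
Proof.
move=> zA.
have mD : measurable D by exact: measurable_itv.
have mDc : measurable (~` D)%classic by exact: measurableC.
pose f (x : R) := (1 - z * x)^-1.
have zx x : D x -> `|z * x| <= 2^-1.
  rewrite /D /= in_itv /= -ltr_norml => xA; rewrite normrM.
  have -> : 2^-1 = (A *+ 4)^-1 * (A *+ 2) :> R.
    have -> : A *+ 4 = 2 * (A *+ 2) by rewrite mulr_natl -mulrnA.
    by rewrite invfM -mulrA mulVf ?mulr1 // gt_eqF // mulrn_wgt0.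
  by rewrite ler_pM // ltW.
have den x : D x -> 2^-1 <= 1 - z * x.
  by move/zx; rewrite ler_norml => /andP[? ?]; lra.
have fb x : D x -> `|f x| <= 2.
  move=> /den h; rewrite ger0_norm; last by rewrite invr_ge0; lra.
  by rewrite -[leRHS]invrK lef_pV2 // posrE; lra.
have mf : measurable_fun [set: R] f.
  have E : f = (fun x => x^-1) \o (fun x => (1 - z *: 'X : {poly R}).[x]).
    by apply/funext => x; rewrite /f /= !hornerE.
  rewrite E; apply: measurableT_comp; first exact: measurable_invr.
  have [/integrableP[+ _] _] := integrable_poly fm (1 - z *: 'X).
  by move/measurable_EFinP.
have DcDc : ([set: R] `\` ~` D)%classic = D by rewrite setDE setTI setCK.
have intD : rho.-integrable D (EFin \o f).
  apply: measurable_bounded_integrable => //.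
  - by rewrite ltey_eq fin_num_measure.
  - exact: measurable_funTS.
  - exists 2; split=> // M M2 x Dx /=.
    by rewrite (le_trans (fb x Dx)) // ltW.
have intT : rho.-integrable setT (EFin \o f).
  apply/(negligible_integrable mDc measurableT _ support_bound).
    by apply/measurable_EFinP.
  by rewrite DcDc.
split=> //.
have IE (u : R -> R) : rho.-integrable setT (EFin \o u) ->
    \int[rho]_x u x = \int[rho]_(x in D) u x.
  move=> iu; rewrite /Rintegral (negligible_integral mDc measurableT iu support_bound).
  by rewrite DcDc.
pose S n : {poly R} := \sum_(k < n) (z ^+ k) *: 'X^k.
have SE n : series (fun k => moment rho k * z ^+ k) n = \int[rho]_x (S n).[x].
  rewrite Rintegral_poly // /S linear_sum /series /= big_mkord; apply: eq_bigr => k _.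
  by rewrite linearZ /= mom_linXn mulrC.
have key n : `|\int[rho]_x f x - series (fun k => moment rho k * z ^+ k) n| <=
    2 * 2^-1 ^+ n.
  have [iS _] := integrable_poly fm (S n).
  rewrite SE -RintegralB // IE; last first.
    have := integrableB measurableT intT iS.
    by apply: eq_integrable => // x _; rewrite /= EFinB.
  have iB : rho.-integrable D (EFin \o (fun x => f x - (S n).[x])).
    have := integrableB mD intD (integrableS measurableT mD (@subsetT _ D) iS).
    by apply: eq_integrable => // x _; rewrite /= EFinB.
  apply: (le_trans (le_normr_Rintegral mD iB)).
  apply: (@le_trans _ _ (\int[rho]_(x in D) (2 * 2^-1 ^+ n))).
    apply: le_Rintegral => //.
    - exact: integrable_norm.
    - apply: measurable_bounded_integrable => //.
        by rewrite ltey_eq fin_num_measure.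
      exists `|2 * 2^-1 ^+ n|; split=> // M M2 x Dx /=; exact: ltW.
    move=> x Dx.
    have d0 : 1 - z * x != 0 by rewrite gt_eqF //; have := den x Dx; lra.
    (* Remainder of the geometric series, at most 2 * 2^-n on [D]. *)
    have -> : f x - (S n).[x] = (z * x) ^+ n * f x.
      apply: (mulIf d0); rewrite mulrBl -mulrA /f mulVf // mulr1.
      have -> : (S n).[x] = \sum_(k < n) (z * x) ^+ k.
        rewrite /S horner_sum; apply: eq_bigr => k _.
        by rewrite hornerZ hornerXn exprMn.
      by rewrite -[1 - z * x]opprB mulrN opprK mulrC -subrX1 addrC subrK.
    rewrite normrM mulrC ler_pM // ?fb // normrX lerXn2r ?nnegrE ?zx //.
  rewrite Rintegral_cst //; rewrite -[leRHS]mulr1 ler_wpM2l //.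
  rewrite -[leRHS]/(fine 1%:E) fine_le ?fin_num_measure //; exact: probability_le1.
apply/cvgrPdist_le => e e0.
have C0 : ((fun n => 2 * 2^-1 ^+ n : R) @ \oo --> (0 : R))%classic.
  rewrite -[X in (_ --> X)%classic](mulr0 2); apply: cvgMr.
  by apply: cvg_expr; rewrite ger0_norm ?invr_ge0 //; lra.
near=> n; rewrite (le_trans (key n)) // (le_trans (ler_norm _)) //.
near: n; exact: cvgr0_norm_le.
Unshelve. all: by end_near. Qed.

End Support.

(** * Polynomial Jacobi parameters *)

Section TopCumulant.
Variable R : realType.
Implicit Types r : nat -> R.

Lemma nc_sum_agree r r' n : (forall k, (k <= n)%N -> r k = r' k) ->
  nc_sum r n = nc_sum r' n.
Proof.
move=> rr; rewrite !nc_sumE; apply: eq_nc_weight => V _; apply: rr.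
by rewrite -[leqRHS]card_ord max_card.
Qed.

Lemma nc_sum_first_agree r r' j n : (forall k, (k <= j + n.+1)%N -> r k = r' k) ->
  nc_sum_first r j n = nc_sum_first r' j n.
Proof.
move=> rr; apply: eq_nc_weight => V _; apply: rr; rewrite addnC leq_add //.
  by rewrite -[leqRHS]muln1 leq_mul2l leq_b1 orbT.
by rewrite -[leqRHS]card_ord max_card.
Qed.

(** The highest cumulant occurs only in the one-block partition, with coefficient 1; in the
    recursion it hides in the term i = 0. *)
Lemma nc_sum_first_top r r' j n : (forall k, (k < j + n.+1)%N -> r k = r' k) ->
  nc_sum_first r j n - nc_sum_first r' j n = r (j + n.+1)%N - r' (j + n.+1)%N.
Proof.
elim: n j => [|n IHn] j rr; rewrite !nc_sum_first_rec.
  by rewrite !big_ord0 !addr0 !nc_sum_0 !mulr1 addn1.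
rewrite (rr j.+1); last lia.
rewrite (@nc_sum_agree r r' n.+1); last by move=> k kn; apply: rr; lia.
rewrite opprD addrACA subrr add0r !big_ord_recl !nc_sum_0 !mul1r subSS subn0.
rewrite -(addSnnS j) -IHn; last by move=> k kn; apply: rr; lia.
rewrite opprD addrACA [X in _ + X](_ : _ = 0) ?addr0 //.
apply/eqP; rewrite subr_eq0; apply/eqP; apply: eq_bigr => i _; rewrite lift0.
have := ltn_ord i => lin.
rewrite (@nc_sum_agree r r' i.+1); last by move=> k ki; apply: rr; lia.
by congr (_ * _); apply: nc_sum_first_agree => k kn; apply: rr; lia.
Qed.

Lemma nc_sum_top r r' n : r 0%N = r' 0%N -> (forall k, (k < n)%N -> r k = r' k) ->
  nc_sum r n - nc_sum r' n = r n - r' n.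
Proof.
case: n => [|n] r0 rr; first by rewrite !nc_sum_0 r0 !subrr.
by rewrite !nc_sum_firstE nc_sum_first_top.
Qed.

End TopCumulant.

Lemma poly_nat_roots_eq0 (R : realType) (q : {poly R}) (N : nat) :
  (forall t : nat, (N <= t)%N -> q.[t%:R] = 0) -> q = 0.
Proof.
move=> qt; apply: (@roots_geq_poly_eq0 R q [seq i%:R | i <- iota N (size q)]).
- by apply/allP => _ /mapP[t + ->]; rewrite mem_iota => /andP[Nt _]; apply/eqP/qt.
- by rewrite map_inj_uniq ?iota_uniq // => i j /eqP; rewrite eqr_nat => /eqP.
- by rewrite size_map size_iota.
Qed.

Section PolynomialParameters.
Variables (R : realType) (mu : probability R R) (beta gamma : nat -> R).
Hypothesis mu_jacobi : is_jacobi mu beta gamma.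
Hypothesis g_neq0 : gamma 0%N != 0.

Local Notation kappa := (free_cumulant mu).
Let b := beta 1%N - beta 0%N.
Let c := gamma 1%N - gamma 0%N.
Local Notation r := (meixner_cumulant (beta 0%N) (gamma 0%N) b c).
Let bt (t : R) := head_tail (beta 0%N * t) (b + beta 0%N * t).
Let gt (t : R) := head_tail (gamma 0%N * t) (c + gamma 0%N * t).

(* If the free cumulants of [mu] agree with those of the free Meixner model
   below order [n], only the parameter of order [n] can deviate from the model,
   and it does so in proportion to the deviation of the [n]-th cumulant. *)
Lemma meixner_deviation (nu : probability R R) beta' gamma' (t : R) n m :
  is_jacobi nu beta' gamma' ->
  (forall k, moment nu k = nc_sum (fun i => t * kappa i) k) ->
  (forall k, (k < n)%N -> kappa k = r k) ->
  jacobi_defined (gt t) m ->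
  (n = m.*2.+1 -> jacobi_defined gamma' m /\
     (beta' m - bt t m) * \prod_(i < m) gt t i = t * (kappa n - r n)) /\
  (n = m.*2.+2 -> jacobi_defined gamma' m /\
     (gamma' m - gt t m) * \prod_(i < m) gt t i = t * (kappa n - r n)).
Proof.
move=> Jnu mE kr dm.
have ME k : motzkin beta' gamma' k 0 = nc_sum (fun i => t * kappa i) k.
  by rewrite -mE (is_jacobi_moment Jnu).
have M'E k : motzkin (bt t) (gt t) k 0 = nc_sum (fun i => t * r i) k.
  by rewrite nc_sum_meixner.
have k0 : kappa 0%N = r 0%N by rewrite (free_cumulantP mu).1.
have low k : (k <= n.-1)%N -> (0 < n)%N ->
    motzkin (bt t) (gt t) k 0 = motzkin beta' gamma' k 0.
  move=> kn n0; rewrite ME M'E; apply: nc_sum_agree => i ik.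
  by rewrite kr //; lia.
have top : motzkin beta' gamma' n 0 - motzkin (bt t) (gt t) n 0 = t * (kappa n - r n).
  rewrite ME M'E nc_sum_top ?mulrBr ?k0 // => k kn; by rewrite kr.
have ag : (0 < n)%N -> (m.*2 <= n.-1)%N -> forall i, (i < m)%N ->
    bt t i = beta' i /\ gt t i = gamma' i.
  move=> n0 mn i im; have di : jacobi_defined (gt t) i.
    by move=> j ji; apply: dm; exact: ltn_trans im.
  have [h1 h2] := motzkin_inj (fun k kn => low k kn n0) di.
  by split; [apply: h1|apply: h2]; lia.
have df : (0 < n)%N -> (m.*2 <= n.-1)%N -> jacobi_defined gamma' m.
  by move=> n0 mn i im; rewrite -(ag n0 mn i im).2; exact: dm.
split=> nE.
  have n0 : (0 < n)%N by lia.
  have mn : (m.*2 <= n.-1)%N by lia.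
  split; first exact: df.
  have nm : (n + 0)%N = m.*2.+1 by lia.
  have := motzkin_beta (ag n0 mn) nm (leq0n m).
  by rewrite -top => h; rewrite -opprB mulNr -h opprB.
have n0 : (0 < n)%N by lia.
have mn : (m.*2 <= n.-1)%N by lia.
split; first exact: df.
have nm : (n + 0)%N = m.*2.+2 by lia.
have bm : bt t m = beta' m.
  by apply: (motzkin_inj (fun k kn => low k kn n0) dm).1; lia.
have := motzkin_gamma (ag n0 mn) bm nm (leq0n m).
by rewrite -top => h; rewrite -opprB mulNr -h opprB.
Qed.

Lemma prod_meixner_gamma (t : R) m :
  \prod_(i < m.+1) gt t i = gamma 0%N * t * (c + gamma 0%N * t) ^+ m.
Proof.
rewrite big_ord_recl; congr (_ * _); rewrite /gt /head_tail /=.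
by rewrite prodr_const card_ord.
Qed.

(** Infinitely many integers make this an identity of polynomials, and at the root - c / gamma 0 of
    the linear factor its left side vanishes. *)
Lemma pole_free (p : {poly R}) (d : R) N m :
  (forall t : nat, (N <= t)%N ->
     p.[t%:R] * (gamma 0%N * (c + gamma 0%N * t%:R) ^+ m.+1) = d) -> d = 0.
Proof.
move=> h; pose l : {poly R} := c%:P + gamma 0%N *: 'X.
have lE x : l.[x] = c + gamma 0%N * x by rewrite !hornerE.
have : p * (gamma 0%N *: l ^+ m.+1) - d%:P = 0.
  apply: (@poly_nat_roots_eq0 _ _ N) => t /h <-.
  by rewrite hornerD hornerN hornerC hornerM hornerZ horner_exp lE subrr.
move/(congr1 (fun q => q.[- c / gamma 0%N])).
rewrite hornerD hornerN hornerC hornerM hornerZ horner_exp lE horner0.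
have -> : c + gamma 0%N * (- c / gamma 0%N) = 0 by rewrite mulrCA divff // mulr1 subrr.
by rewrite expr0n /= !mulr0 add0r => /eqP; rewrite oppr_eq0 => /eqP.
Qed.

Variables (mu_ : nat -> probability R R) (beta_ gamma_ : nat -> nat -> R).
Hypothesis powers : forall t : nat, (0 < t)%N -> is_free_power mu t%:R (mu_ t).
Hypothesis jacobis : forall t : nat, (0 < t)%N ->
  is_jacobi (mu_ t) (beta_ t) (gamma_ t).
Hypothesis polynomial : forall m : nat, exists p q : {poly R},
  forall t : nat, (0 < t)%N -> jacobi_defined (gamma_ t) m ->
    beta_ t m = p.[t%:R] /\ gamma_ t m = q.[t%:R].

Lemma gamma0_gt0 : 0 < gamma 0%N.
Proof. by case: mu_jacobi => _ g0 _; rewrite lt_def g_neq0 g0. Qed.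

(** As [c] may be negative, the model gammas c + gamma 0 * t can vanish for small t; past |c| /
    gamma 0 they are positive. *)
Lemma meixner_gamma_defined : exists2 N : nat, (0 < N)%N &
  forall t : nat, (N <= t)%N -> forall m, jacobi_defined (gt t%:R) m.
Proof.
have g0 := gamma0_gt0.
pose N := (Num.truncn (`|c| / gamma 0%N)).+1.
exists N => // t Nt m i _; rewrite /gt /head_tail; case: ifP => _.
  by rewrite mulf_neq0 // pnatr_eq0; lia.
have ct : `|c| < gamma 0%N * t%:R.
  rewrite mulrC -ltr_pdivrMr // (lt_le_trans (truncnS_gt _)) // ler_nat //.
by move: ct; rewrite ltr_norml => /andP[h _]; rewrite gt_eqF //; lra.
Qed.

Lemma cumulant_meixner n : kappa n = r n.
Proof.
have [N N0 Ndef] := meixner_gamma_defined.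
elim/ltn_ind: n => n IH.
have [->|n0] := posnP n; first by rewrite (free_cumulantP mu).1.
have mE t : (0 < t)%N -> forall k,
    moment (mu_ t) k = nc_sum (fun i => t%:R * kappa i) k.
  by move=> t0; exact: moment_free_power (powers t0).
have mE1 k : moment mu k = nc_sum (fun i => 1 * kappa i) k.
  rewrite (free_cumulantP mu).2; apply: eq_nc_sum => i; by rewrite mul1r.
(* The cumulant of odd order 2m + 1 governs [beta m], that of even order 2m + 2 governs
   [gamma m]. *)
have [m nE] : exists m, n = m.*2.+1 \/ n = m.*2.+2.
  exists (n.-1)./2; have := odd_double_half n.-1; case: (odd _) => /=; lia.
apply/eqP; rewrite -subr_eq0; apply/eqP.
(* In columns 0 and 1 the model at t = 1 agrees with [mu] by the choice of [b] and [c], so applying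
   the deviation formula to [mu] itself suffices. Polynomiality is called on from column 2 on. *)
case: m nE => [|[|m]] nE.
- have d0 : jacobi_defined (gt 1) 0 by [].
  have [h1 h2] := meixner_deviation mu_jacobi mE1 IH d0.
  case: nE => nE; [have [_ +] := h1 nE|have [_ +] := h2 nE].
    by rewrite big_ord0 /bt /head_tail /= mulr1 subrr mul0r mul1r.
  by rewrite big_ord0 /gt /head_tail /= mulr1 subrr mul0r mul1r.
- have d1 : jacobi_defined (gt 1) 1.
    by move=> [|i] // _; rewrite /gt /head_tail /= mulr1.
  have [h1 h2] := meixner_deviation mu_jacobi mE1 IH d1.
  case: nE => nE; [have [_ +] := h1 nE|have [_ +] := h2 nE].
    by rewrite /bt /head_tail /= mulr1 subrK subrr mul0r mul1r.
  by rewrite /gt /head_tail /= mulr1 subrK subrr mul0r mul1r.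
have [p [q pq]] := polynomial m.+2.
case: nE => nE.
  apply: (@pole_free (p - (b%:P + beta 0%N *: 'X)) _ N m) => t Nt.
  have t0 : (0 < t)%N by lia.
  have t0' : t%:R != 0 :> R by rewrite pnatr_eq0 -lt0n.
  have [h1 _] := meixner_deviation (jacobis t0) (mE t t0) IH (Ndef t Nt m.+2).
  have [df +] := h1 nE.
  rewrite (pq t t0 df).1 prod_meixner_gamma /bt /head_tail /= => E.
  (* The factor t of the first model gamma cancels against the t multiplying the cumulant deviation,
     leaving a right side constant in t. *)
  apply: (mulfI t0'); rewrite -E hornerD hornerN hornerD hornerC hornerZ hornerX.
  by move: ((c + _) ^+ _) => C; ring.
apply: (@pole_free (q - (c%:P + gamma 0%N *: 'X)) _ N m) => t Nt.
have t0 : (0 < t)%N by lia.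
have t0' : t%:R != 0 :> R by rewrite pnatr_eq0 -lt0n.
have [_ h2] := meixner_deviation (jacobis t0) (mE t t0) IH (Ndef t Nt m.+2).
have [df +] := h2 nE.
rewrite (pq t t0 df).2 prod_meixner_gamma {1}/gt /head_tail /= => E.
apply: (mulfI t0'); rewrite -E hornerD hornerN hornerD hornerC hornerZ hornerX.
by move: ((c + _) ^+ _) => C; ring.
Qed.

Lemma polynomial_tail_constant : jacobi_tail_constant beta gamma.
Proof.
move=> m m1 dm.
have ME k : motzkin beta gamma k 0 = motzkin (bt 1) (gt 1) k 0.
  rewrite -(is_jacobi_moment mu_jacobi) (free_cumulantP mu).2 -nc_sum_meixner.
  by apply: eq_nc_sum => i; rewrite mul1r cumulant_meixner.
have [h1 h2] := @motzkin_inj _ _ _ _ _ m.*2.+2 (fun k _ => ME k) m dm.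
rewrite h1 // h2 // /bt /gt /head_tail gtn_eqF //.
by rewrite !mulr1 !subrK.
Qed.

End PolynomialParameters.

(** * Constant tails *)

Section ConstantTail.
Variables (R : realType) (mu : probability R R) (beta gamma : nat -> R).
Hypothesis mu_jacobi : is_jacobi mu beta gamma.
Hypothesis tail : jacobi_tail_constant beta gamma.

Let b := beta 1%N - beta 0%N.
Let c := gamma 1%N - gamma 0%N.
Let bt (t : R) := head_tail (beta 0%N * t) (b + beta 0%N * t).
Let gt (t : R) := head_tail (gamma 0%N * t) (c + gamma 0%N * t).

Lemma tail_cumulant :
  free_cumulant mu =1 meixner_cumulant (beta 0%N) (gamma 0%N) b c.
Proof.
apply: meixner_free_cumulant => n; rewrite (is_jacobi_moment mu_jacobi).
apply: motzkin_defined_eq => -[|m] dm; first by [].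
by rewrite /head_tail /=; exact: tail.
Qed.

Lemma free_power_moment (t : R) (nu : probability R R) : is_free_power mu t nu ->
  moment nu =1 (fun n => motzkin (bt t) (gt t) n 0).
Proof.
move=> nuP n; rewrite (moment_free_power nuP) -nc_sum_meixner.
by apply: eq_nc_sum => k; rewrite tail_cumulant.
Qed.

Lemma gamma_ge0 m : 0 <= gamma m.
Proof. by case: mu_jacobi. Qed.

Lemma meixner_gamma_ge0 (t : R) : 0 <= t -> 0 <= c + t * gamma 0%N ->
  forall m, 0 <= gt t m.
Proof.
move=> t0 ct m; rewrite /gt /head_tail; case: ifP => _; last by rewrite mulrC.
by rewrite mulr_ge0 ?gamma_ge0.
Qed.

Lemma free_power_exists (t : R) : 0 <= t -> 0 <= c + t * gamma 0%N ->
  exists nu : probability R R, is_free_power mu t nu.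
Proof.
move=> t0 ct; have g0 := meixner_gamma_ge0 t0 ct.
have [nu Jnu] := @head_tail_jacobi_exists R (beta 0%N * t) (b + beta 0%N * t)
  (gamma 0%N * t) (c + gamma 0%N * t) (g0 0%N) (g0 1%N).
exists nu; split; first by case: Jnu.
move=> n _; rewrite tail_cumulant.
have := @free_cumulantE R nu
  (fun k => t * meixner_cumulant (beta 0%N) (gamma 0%N) b c k).
apply; first by rewrite /= mulr0.
by move=> k; rewrite (is_jacobi_moment Jnu) nc_sum_meixner.
Qed.

Lemma free_power_jacobi (t : R) (nu : probability R R) :
  0 <= t -> 0 <= c + t * gamma 0%N -> is_free_power mu t nu ->
  is_jacobi nu (bt t) (gt t).
Proof.
move=> t0 ct nuP; apply: moment_is_jacobi.
- by case: nuP.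
- exact: meixner_gamma_ge0.
- exact: free_power_moment.
Qed.

(** If c < 0, a small power t would make the first model gamma positive and the second negative,
    hence the norm of the second orthogonal polynomial negative. *)
Lemma tail_infinitely_divisible : free_infinitely_divisible mu <-> 0 <= c.
Proof.
split=> [idiv|c0 t t0]; last first.
  by apply: free_power_exists => //; rewrite addr_ge0 // mulr_ge0 // gamma_ge0.
rewrite leNgt; apply/negP => c0.
have g0 : 0 < gamma 0%N by have := gamma_ge0 1; move: c0; rewrite /c; lra.
(* Chosen so that gamma 0 * t = - c / 2 > 0 and c + gamma 0 * t = c / 2 < 0. *)
pose t : R := - c / 2 / gamma 0%N.
have gt2 : gamma 0%N * t = - c / 2 by rewrite mulrC divfK // gt_eqF.
have t0 : 0 < t by rewrite !divr_gt0 ?oppr_gt0.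
have [nu nuP] := idiv t (ltW t0).
have := mom_lin_sqr_ge0 (proj1 nuP) (orth_poly (bt t) (gt t) 2).
have -> : moment nu = (fun n => motzkin (bt t) (gt t) n 0).
  by apply/funext; exact: free_power_moment.
rewrite mom_lin_orth_sqr /jac_norm 2!big_ord_recl big_ord0 mulr1 /gt /head_tail /=.
rewrite gt2 => h.
have : 0 < - c / 2 by rewrite divr_gt0 ?oppr_gt0.
by move=> h2; move: h; rewrite pmulr_rge0 //; lra.
Qed.

Lemma R_transform_tail (rho : probability R R) :
  is_jacobi rho (fun=> b) (fun=> c) ->
  forall k, R_transform mu k = match k with
    | 0%N => 0
    | 1%N => beta 0%N
    | k'.+2 => gamma 0%N * \int[rho]_x (x ^+ k')
    end.
Proof.
move=> Jrho [|[|k]]; rewrite /R_transform tail_cumulant //=.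
by rewrite -[\int[rho]_x _]/(moment rho k) (is_jacobi_moment Jrho).
Qed.

(** Each step multiplies the bound by at most the sum 1 + |b| + c of the three step weights; this
    supplies the geometric moment growth for [resolvent_series]. *)
Lemma motzkin_cst_bound n k : 0 <= c ->
  `|motzkin (fun=> b) (fun=> c) n k| <= (1 + `|b| + c) ^+ n.
Proof.
move=> c0; elim: n k => [|n IHn] k.
  by rewrite expr0 /=; case: eqP; rewrite ?normr1 ?normr0.
rewrite exprS mulrDl mulrDl mul1r /= (le_trans (ler_normD _ _)) // lerD //.
  rewrite (le_trans (ler_normD _ _)) // lerD //.
  by rewrite normrM ler_wpM2l.
case: k => [|k]; last by rewrite normrM ger0_norm // ler_wpM2l.
rewrite normr0 mulr_ge0 // exprn_ge0 // addr_ge0 // addr_ge0 //.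
Qed.

Lemma R_transform_series (rho : probability R R) : 0 <= c ->
  is_jacobi rho (fun=> b) (fun=> c) ->
  exists2 e : R, 0 < e & forall z : R, `|z| < e ->
    rho.-integrable setT (fun x : R => ((1 - z * x)^-1)%:E) /\
    (series (fun k => R_transform mu k * z ^+ k) @ \oo -->
       beta 0%N * z + gamma 0%N * z ^+ 2 * \int[rho]_x (1 - z * x)^-1)%classic.
Proof.
move=> c0 Jrho; pose A := 1 + `|b| + c.
have A0 : 0 < A by rewrite /A; have := normr_ge0 b; lra.
have fm : finite_moments rho by case: Jrho.
have mb n : `|moment rho n| <= A ^+ n.
  by rewrite (is_jacobi_moment Jrho) motzkin_cst_bound.
exists (A *+ 4)^-1; first by rewrite invr_gt0 mulrn_wgt0.
move=> z zA; have [int cv] := resolvent_series A0 fm mb zA; split=> //.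
(* The terms of order 0 and 1 are 0 and beta 0 * z; from order 2 on, the series is gamma 0 * z^2
   times the moment series of [rho]. *)
rewrite -(cvg_shiftn 2).
have -> : ([sequence series (fun k => R_transform mu k * z ^+ k) (n + 2)%N]_n) =
  (fun n => beta 0%N * z + gamma 0%N * z ^+ 2 *
     series (fun k => moment rho k * z ^+ k) n).
  apply/funext => n /=; rewrite /series /= addn2 !big_mkord.
  rewrite !big_ord_recl /= !(R_transform_tail Jrho) mul0r add0r expr1 mulr_sumr.
  congr (_ + _); apply: eq_bigr => i _.
  rewrite /bump /= !add1n (R_transform_tail Jrho i.+2).
  by rewrite -[\int[rho]_x _]/(moment rho i) !exprS; ring.
apply: cvgD; first exact: cvg_cst.
by apply: cvgMr.
Qed.

End ConstantTail.

Local Open Scope classical_set_scope.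
Local Open Scope ring_scope.

Theorem theorem3p2 (R : realType) (mu : probability R R)
    (beta gamma : nat -> R)
    (mu_moments : finite_moments mu)
    (mu_jacobi : is_jacobi mu beta gamma) :
  (* (1) *)
  (forall (mu_ : nat -> probability R R) (beta_ gamma_ : nat -> nat -> R),
     (forall t : nat, (0 < t)%N -> is_free_power mu t%:R (mu_ t)) ->
     (forall t : nat, (0 < t)%N -> is_jacobi (mu_ t) (beta_ t) (gamma_ t)) ->
     (forall m : nat, exists p q : {poly R},
        forall t : nat, (0 < t)%N -> jacobi_defined (gamma_ t) m ->
          beta_ t m = p.[t%:R] /\ gamma_ t m = q.[t%:R]) ->
     jacobi_tail_constant beta gamma /\ free_meixner mu)
  /\
  (* (2) *)
  (jacobi_tail_constant beta gamma ->
   let b := beta 1%N - beta 0%N in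
   let c := gamma 1%N - gamma 0%N in
   [/\ forall t : R, 0 <= t -> 0 <= c + t * gamma 0%N ->
         (exists nu : probability R R, is_free_power mu t nu) /\
         (forall nu : probability R R, is_free_power mu t nu ->
            is_jacobi nu
              (fun m => if m == 0%N then beta 0%N * t else b + beta 0%N * t)
              (fun m => if m == 0%N then gamma 0%N * t else c + gamma 0%N * t)),
       free_infinitely_divisible mu <-> 0 <= c
     & 0 <= c ->
         (exists rho : probability R R, is_jacobi rho (fun=> b) (fun=> c)) /\
         (forall rho : probability R R, is_jacobi rho (fun=> b) (fun=> c) ->
            (* as formal power series in z *)
            (forall k : nat, R_transform mu k =
               match k with
               | 0%N => 0
               | 1%N => beta 0%N
               | k'.+2 => gamma 0%N * \int[rho]_x (x ^+ k')
               end) /\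
            (* as functions near z = 0 *)
            (exists2 e : R, 0 < e & forall z : R, `|z| < e ->
               rho.-integrable setT (fun x : R => ((1 - z * x)^-1)%:E) /\
               series (fun k => R_transform mu k * z ^+ k) @ \oo -->
                 beta 0%N * z +
                 gamma 0%N * z ^+ 2 * \int[rho]_x (1 - z * x)^-1)) ]).
Proof.
split.
  move=> mu_ beta_ gamma_ powers jacobis polynomial.
  have tail : jacobi_tail_constant beta gamma.
    (* If gamma 0 = 0, the measure is a point mass and no column past the first is defined, so the
       tail condition is vacuous. *)
    have [g0|g0] := eqVneq (gamma 0%N) 0.
      by move=> m m1 /(_ 0%N m1); rewrite g0 eqxx.
    exact: (polynomial_tail_constant mu_jacobi g0 powers jacobis polynomial).
  by split=> //; exists beta, gamma.
move=> tail b c; split.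
- move=> t t0 ct; split; first exact: (free_power_exists mu_jacobi tail t0 ct).
  by move=> nu; exact: (free_power_jacobi mu_jacobi tail t0 ct).
- exact: (tail_infinitely_divisible mu_jacobi tail).
- move=> c0; split.
    have [rho Jrho] := @head_tail_jacobi_exists R b b c c c0 c0.
    exists rho; apply: moment_is_jacobi => //; first by case: Jrho.
    move=> n; rewrite (is_jacobi_moment Jrho).
    by apply: eq_motzkin => i; rewrite /head_tail; case: ifP.
  move=> rho Jrho; split; first exact: (R_transform_tail mu_jacobi tail Jrho).
  exact: (R_transform_series mu_jacobi tail c0 Jrho).
Qed.
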